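(* Let $A$ be an analytic function in $\mathbb{D}$. If there exists $0\leq r_0<1$ such that $$\int_{r_0}^1M_\infty(r,A)^2\exp\left(2\int_{r_0}^rM_\infty(t,A)(1-t)\,dt\right)(1-r^2)^3\,dr<\infty,$$ then all analytic solutions in $\mathbb{D}$ of the differential equation $f''+Af=0$ belong to $\mathrm{VMOA}$.
   Context: $\mathbb{D}=\{z\in\mathbb{C}:|z|<1\}$ is the open unit disc. For $A$ analytic in $\mathbb{D}$ and $0\le r<1$, $M_\infty(r,A)=\max_{|z|=r}|A(z)|$. Let $\varphi_a(z)=(a-z)/(1-\overline{a}z)$ for $a,z\in\mathbb{D}$; for $f$ analytic in $\mathbb{D}$ and $a\in\mathbb{D}$ put $g_a(z)=f(\varphi_a(z))-f(a)$. Then $f\in\mathrm{VMOA}$ if and only if $\|g_a\|_{H^2}^2\to0$ as $|a|\to1^-$, where $\|g\|_{H^2}^2=\lim_{r\to1^-}\frac1{2\pi}\int_0^{2\pi}|g(re^{i\theta})|^2\,d\theta$. *)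

(* Defs.v *)
From Stdlib Require Import Reals.
From Coquelicot Require Import Coquelicot.
Open Scope R_scope.

Definition in_disc (z : C) : Prop := Cmod z < 1.

(* The base field is C, so [is_derive] and [ex_derive] are complex
   differentiability. *)
Definition analytic_disc (f : C -> C) : Prop :=
  forall z : C, in_disc z -> ex_derive (K := C_AbsRing) (V := C_NormedModule) f z.

Definition deriv_on_disc (f df : C -> C) : Prop :=
  forall z : C, in_disc z -> is_derive (K := C_AbsRing) (V := C_NormedModule) f z (df z).

Definition analytic_solution (A f : C -> C) : Prop :=
  analytic_disc f /\
  exists f1 f2 : C -> C,
    deriv_on_disc f f1 /\ deriv_on_disc f1 f2 /\
    (forall z : C, in_disc z -> (f2 z + A z * f z)%C = RtoC 0).

(* For A analytic in the disc and 0 <= r < 1, this supremum is finite and is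
   attained, by continuity on the compact circle |z| = r. *)
Definition Minf (r : R) (A : C -> C) : R :=
  real (Lub_Rbar (fun x : R => exists z : C, Cmod z = r /\ x = Cmod (A z))).

Definition circle_point (r theta : R) : C := (r * cos theta, r * sin theta).

Definition mean_sq (r : R) (g : C -> C) : R :=
  / (2 * PI) * RInt (fun theta => Cmod (g (circle_point r theta)) ^ 2) 0 (2 * PI).

(* The squared H^2 norm of g is finite and equal to l.  For g analytic in the
   disc the means increase with r, so when no such real l exists the norm is
   infinite. *)
Definition is_H2_normsq (g : C -> C) (l : R) : Prop :=
  filterlim (fun r => mean_sq r g) (at_left 1) (locally l).

Definition phi (a z : C) : C := ((a - z) / (RtoC 1 - Cconj a * z))%C.

Definition hyp_translate (f : C -> C) (a z : C) : C := (f (phi a z) - f a)%C.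

(* The squared H^2 norm of [hyp_translate f a] tends to 0 as |a| -> 1-; this
   includes its finiteness for |a| close to 1. *)
Definition VMOA (f : C -> C) : Prop :=
  analytic_disc f /\
  forall eps : R, 0 < eps ->
    exists rho : R, rho < 1 /\
      forall a : C, rho < Cmod a < 1 ->
        exists l : R, is_H2_normsq (hyp_translate f a) l /\ l < eps.

(* Main.v *)
Require Import Defs.
From Stdlib Require Import Reals Lra Psatz.
From Coquelicot Require Import Coquelicot.
Open Scope R_scope.

(** Let [M] be the maximum modulus of [A].  Gronwall's inequality along the rays from the
    origin, applied to [f'' = - A f], gives [|f z| <= K exp (E |z|)], where [E] is the primitive
    of [M t (1 - t)] ([solution_derivative_growth]).  So [|f''|] is at most
    [p = K M exp E] at radius [r], and the hypothesis says that [p ^ 2 (1 - r) ^ 3] is integrable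
    ([second_derivative_bound_integrable]).  By Hardy's inequality the primitive [D] of [p],
    which bounds [|f'|], has [D ^ 2 (1 - r)] integrable.

    This integrability is exactly what a bounded radial function needs in order to have
    Laplacian [4 D ^ 2]: [radial_majorant] builds a bounded nondecreasing [F] such that
    [F (|w| ^ 2)] has a Laplacian at least [4 |f' w| ^ 2].  Since [4 |f'| ^ 2] is the Laplacian
    of [|f - f a| ^ 2], the function [F (|w| ^ 2) - |f w - f a| ^ 2] is subharmonic, and so is its
    composition with [phi a].  Its value [F (|a| ^ 2)] at [0] is at most its mean over any circle
    about [0], so
    [mean_sq r (hyp_translate f a) <= F 1 - F (|a| ^ 2)], where [F 1] is the limit of [F] at [1].
    The right side does not depend on [r] and tends to [0] as [|a|] tends to [1]
    ([VMOA_of_radial_majorant]).  The comparison replaces Carleson measures and the change of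
    variables in the Littlewood-Paley formula.

    Subharmonicity is used only through the monotonicity of circle means, which follows by
    differentiating under the integral in polar coordinates
    ([circle_integral_nondecreasing]).  Solutions are twice continuously
    differentiable thanks to the equation itself, so this needs no Cauchy formula. *)

(** * Differentiation along curves in the plane *)

Lemma nondecreasing_of_derive (f df : R -> R) (a b : R) :
  a <= b ->
  (forall x, a <= x <= b -> is_derive f x (df x)) ->
  (forall x, a < x < b -> 0 <= df x) ->
  f a <= f b.
Proof.
intros hab hd hpos.
destruct (Req_dec a b) as [->|hne]; [lra|].
destruct (MVT_cor2 f df a b) as [c [hc hc']]; [lra| |].
- intros c hc. apply is_derive_Reals, hd, hc.
- assert (0 <= df c) by (apply hpos; lra). nra.
Qed.

Definition dot (z w : C) : R := Re z * Re w + Im z * Im w.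

Lemma dot_self (z : C) : dot z z = Cmod z ^ 2.
Proof. rewrite Cmod2_alt. unfold dot. ring. Qed.

(** Componentwise, so that the real differentiation and continuity lemmas apply directly. *)
Definition is_cderive (g : R -> C) (x : R) (d : C) : Prop :=
  is_derive (fun s => Re (g s)) x (Re d) /\ is_derive (fun s => Im (g s)) x (Im d).

(** Complex derivatives use the discs of the modulus as neighbourhoods, whereas [C] as a
    product of two lines uses squares.  The two kinds of neighbourhoods are the same up to a
    factor [sqrt 2]. *)
Lemma locally_C_of_AbsRing (z : C) (P : C -> Prop) :
  locally (T := AbsRing_UniformSpace C_AbsRing) z P -> locally (T := C_UniformSpace) z P.
Proof.
intros [eps hP].
assert (h2 : 0 < eps / sqrt 2).
{ apply Rdiv_lt_0_compat; [apply eps|]. apply sqrt_lt_R0. lra. }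
exists (mkposreal _ h2). intros w hw. apply hP.
assert (k := C_NormedModule_mixin_compat2 z w (mkposreal _ h2) hw). simpl in k.
replace (sqrt 2 * (eps / sqrt 2)) with (pos eps) in k; [exact k|].
field. apply Rgt_not_eq, sqrt_lt_R0. lra.
Qed.

Lemma locally_AbsRing_of_C (z : C) (P : C -> Prop) :
  locally (T := C_UniformSpace) z P -> locally (T := AbsRing_UniformSpace C_AbsRing) z P.
Proof.
intros [eps hP]. exists eps. intros w hw. apply hP.
exact (C_NormedModule_mixin_compat1 z w eps hw).
Qed.

Definition Ccontinuous (h : C -> C) (z : C) : Prop :=
  continuous (T := AbsRing_UniformSpace C_AbsRing) (U := AbsRing_UniformSpace C_AbsRing) h z.

(** The two normed module structures on [C] have the same norm and operations but are not
    convertible, and the calculus rules with values in the field are stated for the second. *)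
Lemma is_derive_C_AbsRing (h : C -> C) (z d : C) :
  is_derive (K := C_AbsRing) (V := C_NormedModule) h z d <->
  is_derive (K := C_AbsRing) (V := AbsRing_NormedModule C_AbsRing) h z d.
Proof.
split; intros [_ H]; (split; [apply is_linear_scal_l|exact H]).
Qed.

Lemma Ccontinuous_of_derive (h : C -> C) (z d : C) :
  is_derive (K := C_AbsRing) (V := C_NormedModule) h z d -> Ccontinuous h z.
Proof.
intros H. apply (ex_derive_continuous (K := C_AbsRing) (V := AbsRing_NormedModule C_AbsRing)).
exists d. now apply is_derive_C_AbsRing.
Qed.

(** The hypotheses on [p] say that it is real linear of norm at most one, as the real
    and the imaginary part are. *)
Lemma filterdiff_component (h : C -> C) (z d : C) (p : C -> R) :
  (forall u v, p (u + v)%C = p u + p v) ->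
  (forall (k : R) u, p (RtoC k * u)%C = k * p u) ->
  (forall u, Rabs (p u) <= Cmod u) ->
  is_derive (K := C_AbsRing) (V := C_NormedModule) h z d ->
  filterdiff (K := R_AbsRing) (U := C_R_NormedModule) (V := R_NormedModule)
    (fun w : C => p (h w)) (locally z) (fun w : C => p (w * d)%C).
Proof.
intros padd pscal ple [_ H].
assert (pscal' : forall (k : R) u, p (k * fst u, k * snd u) = k * p u).
{ intros k u. rewrite <- pscal. f_equal. unfold Cmult, RtoC. simpl. f_equal; ring. }
split.
- split.
  + intros u v. unfold plus at 2; simpl. rewrite <- padd.
    f_equal. change (((u + v) * d = u * d + v * d)%C). ring.
  + intros k u. unfold scal at 2; simpl. unfold mult; simpl. rewrite <- pscal.
    f_equal. unfold scal; simpl. unfold mult, prod_scal, scal; simpl. unfold mult; simpl.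
    destruct u as [u1 u2], d as [d1 d2]. unfold Cmult, RtoC; simpl. f_equal; ring.
  + exists (Cmod d + 1). split; [pose proof (Cmod_ge_0 d); lra|].
    intros u. rewrite <- Cmod_norm. apply Rle_trans with (1 := ple _).
    rewrite Cmod_mult. pose proof (Cmod_ge_0 u). nra.
- intros w hw.
  assert (hw' : z = w).
  { apply (is_filter_lim_locally_unique (V := C_R_NormedModule)). exact hw. }
  subst w. intros eps.
  generalize (locally_C_of_AbsRing _ _ (H z (fun P hP => hP) eps)).
  apply filter_imp. intros w hw'.
  change (Cmod (h w - h z - (w - z) * d)%C <= eps * Cmod (w - z)%C) in hw'.
  rewrite <- Cmod_norm.
  apply Rle_trans with (2 := hw').
  apply Rle_trans with (2 := ple _).
  apply Req_le. unfold norm, minus, plus, opp; simpl. unfold abs; simpl. f_equal.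
  assert (popp : forall u, p (- u)%C = - p u).
  { intros u. replace (- u)%C with (RtoC (-1) * u)%C.
    rewrite pscal. ring. unfold Cmult, RtoC, Copp. simpl. f_equal; ring. }
  unfold Cminus at 1 2. rewrite !padd, !popp. reflexivity.
Qed.

Lemma C_derive_along (h : C -> C) (g : R -> C) (x : R) (d c : C) :
  is_derive (K := C_AbsRing) (V := C_NormedModule) h (g x) d ->
  is_cderive g x c -> is_cderive (fun s => h (g s)) x (d * c)%C.
Proof.
intros hh [h1 h2].
assert (key : forall p : C -> R,
  (forall u v, p (u + v)%C = p u + p v) ->
  (forall (k : R) u, p (RtoC k * u)%C = k * p u) ->
  (forall u, Rabs (p u) <= Cmod u) ->
  is_derive (fun s => p (h (g s))) x (p (d * c)%C)).
{ intros p padd pscal ple.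
  apply (is_derive_ext (fun s => p (h (Re (g s), Im (g s))))).
  { intros t. now rewrite <- surjective_pairing. }
  assert (hp := filterdiff_component h (g x) d p padd pscal ple hh).
  unfold is_derive.
  eapply filterdiff_ext_lin.
  - apply (filterdiff_comp'_2 (fun s => Re (g s)) (fun s => Im (g s))
      (fun u v => p (h (u, v))) x _ _ (fun u v => p ((u, v) * d)%C) h1 h2).
    replace (Re (g x), Im (g x)) with (g x) by apply surjective_pairing.
    eapply filterdiff_ext; [|eapply filterdiff_ext_lin; [apply hp|]].
    + intros y. simpl. now rewrite <- surjective_pairing.
    + intros y. simpl. now rewrite <- surjective_pairing.
  - intros y. simpl. rewrite <- pscal. f_equal.
    unfold scal; simpl. unfold mult; simpl. destruct c, d.
    unfold Cmult, RtoC; simpl. f_equal; ring. }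
split.
- apply key.
  + reflexivity.
  + intros k u. unfold Re, Cmult; simpl. ring.
  + apply re_le_Cmod.
- apply key.
  + reflexivity.
  + intros k u. unfold Im, Cmult; simpl. ring.
  + intros u. apply Rle_trans with (2 := Rmax_Cmod u). apply Rmax_r.
Qed.

Lemma is_cderive_mult (g1 g2 : R -> C) (x : R) (d1 d2 : C) :
  is_cderive g1 x d1 -> is_cderive g2 x d2 ->
  is_cderive (fun s => g1 s * g2 s)%C x (d1 * g2 x + g1 x * d2)%C.
Proof.
intros [a1 b1] [a2 b2].
split; simpl; unfold Re, Im in *.
- evar_last.
  + apply (is_derive_minus (V := R_NormedModule)); apply (is_derive_mult (K:=R_AbsRing));
      try apply Rmult_comm; eassumption.
  + unfold minus, plus, opp, mult; simpl. ring.
- evar_last.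
  + apply (is_derive_plus (V := R_NormedModule)); apply (is_derive_mult (K:=R_AbsRing));
      try apply Rmult_comm; eassumption.
  + unfold minus, plus, opp, mult; simpl. ring.
Qed.

Lemma is_derive_dot (g1 g2 : R -> C) (x : R) (d1 d2 : C) :
  is_cderive g1 x d1 -> is_cderive g2 x d2 ->
  is_derive (fun s => dot (g1 s) (g2 s)) x (dot d1 (g2 x) + dot (g1 x) d2).
Proof.
intros [a1 b1] [a2 b2]. unfold dot.
evar_last.
- apply (is_derive_plus (V := R_NormedModule)); apply (is_derive_mult (K:=R_AbsRing));
    try apply Rmult_comm; eassumption.
- unfold minus, plus, opp, mult; simpl. ring.
Qed.

(** * Subharmonicity in polar coordinates *)

Definition ccont_2d (g : R -> R -> C) (r t : R) : Prop :=
  continuity_2d_pt (fun u v => Re (g u v)) r t /\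
  continuity_2d_pt (fun u v => Im (g u v)) r t.

Lemma ccont_2d_mult (g1 g2 : R -> R -> C) r t :
  ccont_2d g1 r t -> ccont_2d g2 r t -> ccont_2d (fun u v => g1 u v * g2 u v)%C r t.
Proof.
intros [a1 b1] [a2 b2]; split; unfold Re, Im in *; simpl.
- apply continuity_2d_pt_minus; apply continuity_2d_pt_mult; assumption.
- apply continuity_2d_pt_plus; apply continuity_2d_pt_mult; assumption.
Qed.

Lemma ccont_2d_plus (g1 g2 : R -> R -> C) r t :
  ccont_2d g1 r t -> ccont_2d g2 r t -> ccont_2d (fun u v => g1 u v + g2 u v)%C r t.
Proof.
intros [a1 b1] [a2 b2]; split; unfold Re, Im in *; simpl;
  apply continuity_2d_pt_plus; assumption.
Qed.

Lemma continuity_2d_dot (g1 g2 : R -> R -> C) r t :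
  ccont_2d g1 r t -> ccont_2d g2 r t ->
  continuity_2d_pt (fun u v => dot (g1 u v) (g2 u v)) r t.
Proof.
intros [a1 b1] [a2 b2]. unfold dot.
apply continuity_2d_pt_plus; apply continuity_2d_pt_mult; assumption.
Qed.

Lemma continuous_ccont_2d (g : R -> R -> C) r t :
  continuous (fun z : R * R => g (fst z) (snd z)) (r, t) <-> ccont_2d g r t.
Proof.
split.
- intros H. split; apply continuity_2d_pt_filterlim.
  + apply (continuous_comp (fun z : R * R => g (fst z) (snd z)) (fun w : R * R => fst w));
      [exact H|].
    apply (continuous_fst (U := R_UniformSpace) (V := R_UniformSpace)).
  + apply (continuous_comp (fun z : R * R => g (fst z) (snd z)) (fun w : R * R => snd w));
      [exact H|].
    apply (continuous_snd (U := R_UniformSpace) (V := R_UniformSpace)).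
- intros [h1 h2].
  apply continuity_2d_pt_filterlim in h1. apply continuity_2d_pt_filterlim in h2.
  intros P [eps hP].
  assert (e1 := h1 _ (locally_ball _ eps)).
  assert (e2 := h2 _ (locally_ball _ eps)).
  unfold filtermap in *.
  generalize (filter_and _ _ e1 e2). apply filter_imp.
  intros z [k1 k2]. apply hP. split; assumption.
Qed.

Lemma continuity_2d_comp_C (h : C -> C) (g : R -> R -> C) r t :
  Ccontinuous h (g r t) -> ccont_2d g r t ->
  ccont_2d (fun u v => h (g u v)) r t.
Proof.
intros hh hg. apply continuous_ccont_2d. apply continuous_ccont_2d in hg.
apply (continuous_comp _ h _ hg). intros P hP.
apply locally_C_of_AbsRing. apply hh. now apply locally_AbsRing_of_C.
Qed.

Ltac split_conj := repeat match goal with |- _ /\ _ => split end.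

(** [V r t] is a function of class C2 on the disc written in polar coordinates; [gradsq] is
    [r ^ 2] times the square of its gradient and [lap] is [r ^ 2] times its Laplacian.  The
    factor [r ^ 2] and the range [-1 < r < 1] make the origin an ordinary point: polar
    coordinates are smooth there, and no one-sided derivative occurs. *)
Definition polar_C2 (V gradsq lap : R -> R -> R) : Prop :=
  exists Vr Vrr Vt Vtt : R -> R -> R,
    forall r t, -1 < r < 1 ->
      (is_derive (fun u => V u t) r (Vr r t) /\
       is_derive (fun u => Vr u t) r (Vrr r t) /\
       is_derive (fun v => V r v) t (Vt r t) /\
       is_derive (fun v => Vt r v) t (Vtt r t)) /\
      (continuity_2d_pt V r t /\ continuity_2d_pt Vr r t /\
       continuity_2d_pt Vrr r t /\ continuity_2d_pt Vt r t /\ continuity_2d_pt Vtt r t) /\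
      V r (2 * PI) = V r 0 /\ Vt r (2 * PI) = Vt r 0 /\
      gradsq r t = (r * Vr r t) ^ 2 + Vt r t ^ 2 /\
      lap r t = r ^ 2 * Vrr r t + r * Vr r t + Vtt r t.

Lemma continuity_2d_slice (V : R -> R -> R) r t :
  continuity_2d_pt V r t -> continuous (V r) t.
Proof.
intros H. apply continuity_2d_pt_filterlim in H.
apply (continuous_comp_2 (fun _ : R => r) (fun v : R => v) V).
- apply continuous_const.
- apply continuous_id.
- exact H.
Qed.

Lemma open_interval_locally r : -1 < r < 1 -> locally r (fun u => -1 < u < 1).
Proof.
intros hr.
apply (open_and (fun u => -1 < u) (fun u => u < 1));
  [apply open_gt | apply open_lt | exact hr].
Qed.

Lemma is_derive_circle_integral (V Vr : R -> R -> R) r :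
  (forall u t, -1 < u < 1 -> is_derive (fun s => V s t) u (Vr u t)) ->
  (forall u t, -1 < u < 1 -> continuity_2d_pt V u t /\ continuity_2d_pt Vr u t) ->
  -1 < r < 1 ->
  is_derive (fun u => RInt (V u) 0 (2 * PI)) r (RInt (Vr r) 0 (2 * PI)).
Proof.
intros hd hc hr.
assert (hl := open_interval_locally r hr).
evar_last.
- apply (is_derive_RInt_param V 0 (2 * PI) r).
  + revert hl. apply filter_imp. intros u hu t _. exists (Vr u t). now apply hd.
  + intros t _.
    apply continuity_2d_pt_ext_loc with Vr; [|now apply hc].
    destruct hl as [e he]. exists e. intros u v hu _.
    symmetry. apply is_derive_unique, hd, he, hu.
  + revert hl. apply filter_imp. intros u hu.
    apply (ex_RInt_continuous (V := R_CompleteNormedModule)). intros t _.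
    now apply continuity_2d_slice, hc.
- apply RInt_ext. intros t _. now apply is_derive_unique, hd.
Qed.

(** The mean value inequality for subharmonic functions.  Let [J] be the circle integral.
    Integrating [r ^ 2 Vrr + r Vr + Vtt >= 0] over the circle kills [Vtt] by periodicity and
    leaves [r (r J')' >= 0]; as [r J'] vanishes at [0], [J' >= 0]. *)
Lemma circle_integral_nondecreasing (V gradsq lap : R -> R -> R) :
  polar_C2 V gradsq lap ->
  (forall r t, 0 <= r < 1 -> 0 <= lap r t) ->
  forall r s, 0 <= r -> r <= s -> s < 1 ->
    RInt (V r) 0 (2 * PI) <= RInt (V s) 0 (2 * PI).
Proof.
intros (Vr & Vrr & Vt & Vtt & H) hlap.
assert (hPI := PI_RGT_0).
assert (hint : forall W : R -> R -> R, (forall r t, -1 < r < 1 -> continuity_2d_pt W r t) ->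
  forall r, -1 < r < 1 -> ex_RInt (W r) 0 (2 * PI)).
{ intros W hW r hr. apply (ex_RInt_continuous (V := R_CompleteNormedModule)).
  intros t _. now apply continuity_2d_slice, hW. }
assert (hd0 : forall r, -1 < r < 1 ->
  is_derive (fun u => RInt (V u) 0 (2 * PI)) r (RInt (Vr r) 0 (2 * PI))).
{ intros r hr. apply is_derive_circle_integral; [..|exact hr];
    intros u t hu; [|split]; now apply H. }
assert (hd1 : forall r, -1 < r < 1 ->
  is_derive (fun u => RInt (Vr u) 0 (2 * PI)) r (RInt (Vrr r) 0 (2 * PI))).
{ intros r hr. apply is_derive_circle_integral; [..|exact hr];
    intros u t hu; [|split]; now apply H. }
assert (hlap' : forall r, 0 <= r < 1 ->
  0 <= r * (RInt (Vr r) 0 (2 * PI) + r * RInt (Vrr r) 0 (2 * PI))).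
{ intros r hr.
  assert (hr' : -1 < r < 1) by lra.
  assert (i1 := hint Vr (fun r t hr => proj1 (proj2 (proj1 (proj2 (H r t hr))))) r hr').
  assert (i2 := hint Vrr (fun r t hr => proj1 (proj2 (proj2 (proj1 (proj2 (H r t hr)))))) r hr').
  assert (i3 := hint Vtt (fun r t hr => proj2 (proj2 (proj2 (proj2 (proj1 (proj2 (H r t
      hr))))))) r hr').
  assert (z : is_RInt (Vtt r) 0 (2 * PI) 0).
  { evar_last.
    - apply (is_RInt_derive (V := R_CompleteNormedModule) (Vt r) (Vtt r)).
      + intros t _. now apply H.
      + intros t _. now apply continuity_2d_slice, H.
    - destruct (H r 0 hr') as (_ & _ & _ & hp & _). rewrite hp.
      unfold minus, plus, opp; simpl. ring. }
  assert (I : is_RInt (fun t => r * (Vr r t + r * Vrr r t) + Vtt r t) 0 (2 * PI)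
     (r * (RInt (Vr r) 0 (2 * PI) + r * RInt (Vrr r) 0 (2 * PI)) + 0)).
  { apply (is_RInt_plus (V := R_NormedModule)); [|exact z].
    apply (is_RInt_scal (V := R_NormedModule)).
    apply (is_RInt_plus (V := R_NormedModule)).
    - now apply (RInt_correct (V := R_CompleteNormedModule)).
    - apply (is_RInt_scal (V := R_NormedModule)).
      now apply (RInt_correct (V := R_CompleteNormedModule)). }
  apply (is_RInt_ge_0 _ 0 (2 * PI) _ ltac:(lra)) in I; [lra|].
  intros t _. destruct (H r t hr') as (_ & _ & _ & _ & _ & e).
  specialize (hlap r t hr). rewrite e in hlap. nra. }
assert (hJ1 : forall r, 0 < r < 1 -> 0 <= RInt (Vr r) 0 (2 * PI)).
{ intros r hr.
  assert (k : 0 * RInt (Vr 0) 0 (2 * PI) <= r * RInt (Vr r) 0 (2 * PI)).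
  { apply (nondecreasing_of_derive (fun u => u * RInt (Vr u) 0 (2 * PI))
      (fun u => RInt (Vr u) 0 (2 * PI) + u * RInt (Vrr u) 0 (2 * PI))); [lra| |].
    - intros u hu. evar_last.
      + apply (is_derive_mult (K := R_AbsRing)); [apply is_derive_id| |apply Rmult_comm].
        apply hd1. lra.
      + unfold plus, mult, one; simpl. ring.
    - intros u hu. specialize (hlap' u ltac:(lra)). nra. }
  nra. }
intros r s hr hrs hs.
apply (nondecreasing_of_derive (fun u => RInt (V u) 0 (2 * PI))
  (fun u => RInt (Vr u) 0 (2 * PI))); [exact hrs| |].
- intros u hu. apply hd0. lra.
- intros u hu. apply hJ1. lra.
Qed.

Lemma polar_C2_minus V1 V2 g1 g2 l1 l2 :
  polar_C2 V1 g1 l1 -> polar_C2 V2 g2 l2 ->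
  exists g, polar_C2 (fun r t => V1 r t - V2 r t) g (fun r t => l1 r t - l2 r t).
Proof.
intros (Ar & Arr & At & Att & HA) (Br & Brr & Bt & Btt & HB).
eexists.
exists (fun r t => Ar r t - Br r t), (fun r t => Arr r t - Brr r t),
  (fun r t => At r t - Bt r t), (fun r t => Att r t - Btt r t).
intros r t hr.
destruct (HA r t hr) as ((a1 & a2 & a3 & a4) & (a5 & a6 & a7 & a8' & a8) & a9 & a10 & a11 & a12).
destruct (HB r t hr) as ((b1 & b2 & b3 & b4) & (b5 & b6 & b7 & b8' & b8) & b9 & b10 & b11 & b12).
split_conj; try (apply (is_derive_minus (V := R_NormedModule)); assumption);
  try (apply continuity_2d_pt_minus; assumption).
- cbv beta; now rewrite a9, b9.
- cbv beta; now rewrite a10, b10.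
- reflexivity.
- cbv beta; rewrite a12, b12. ring.
Qed.

(** Chain rule for the Laplacian: [lap (F o q) = F' (q) lap q + F'' (q) |grad q| ^ 2].  The
    gradient is carried along in [polar_C2] for the sake of this rule alone. *)
Lemma polar_C2_comp (F F1 F2 : R -> R) q g l :
  (forall x, 0 <= x < 1 ->
    is_derive F x (F1 x) /\ is_derive F1 x (F2 x) /\ continuous F2 x) ->
  (forall r t, -1 < r < 1 -> 0 <= q r t < 1) ->
  polar_C2 q g l ->
  exists g', polar_C2 (fun r t => F (q r t)) g'
    (fun r t => F1 (q r t) * l r t + F2 (q r t) * g r t).
Proof.
intros hF hq (Ar & Arr & At & Att & HA).
eexists.
exists (fun r t => F1 (q r t) * Ar r t),
  (fun r t => F2 (q r t) * Ar r t ^ 2 + F1 (q r t) * Arr r t),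
  (fun r t => F1 (q r t) * At r t),
  (fun r t => F2 (q r t) * At r t ^ 2 + F1 (q r t) * Att r t).
intros r t hr.
destruct (HA r t hr) as ((a1 & a2 & a3 & a4) & (a5 & a6 & a7 & a8' & a8) & a9 & a10 & a11 & a12).
destruct (hF _ (hq r t hr)) as (f1 & f2 & f3).
assert (c0 : forall F : R -> R, continuous F (q r t) ->
  continuity_2d_pt (fun u v => F (q u v)) r t).
{ intros K hK. apply continuity_1d_2d_pt_comp; [|exact a5].
  now apply continuity_pt_filterlim. }
assert (c1 : continuous F (q r t)).
{ apply (ex_derive_continuous (V := R_NormedModule)). now exists (F1 (q r t)). }
assert (c2 : continuous F1 (q r t)).
{ apply (ex_derive_continuous (V := R_NormedModule)). now exists (F2 (q r t)). }
assert (sq : forall W : R -> R -> R, continuity_2d_pt W r t ->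
  continuity_2d_pt (fun u v => W u v ^ 2) r t).
{ intros W hW. apply (continuity_2d_pt_ext (fun u v => W u v * W u v)).
  - intros x y. ring.
  - now apply continuity_2d_pt_mult. }
assert (chain : forall (K K' p p' : R -> R) (x dp : R), is_derive K (p x) (K' (p x)) ->
  is_derive p x (p' x) -> is_derive p' x dp ->
  forall dK, is_derive K' (p x) dK ->
  is_derive (fun u => K (p u)) x (K' (p x) * p' x) /\
  is_derive (fun u => K' (p u) * p' u) x (dK * p' x ^ 2 + K' (p x) * dp)).
{ intros K K' p p' x dp h1 h2 h3 dK h4. split.
  - evar_last.
    + apply (is_derive_comp K p); eassumption.
    + unfold scal; simpl; unfold mult; simpl. ring.
  - evar_last.
    + apply (is_derive_mult (K := R_AbsRing) (fun u => K' (p u))); [|eassumption|apply Rmult_comm].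
      apply (is_derive_comp K' p); eassumption.
    + unfold plus, mult, scal; simpl; unfold mult; simpl. ring. }
split_conj.
- now apply (chain F F1 (fun u => q u t) (fun u => Ar u t) r (Arr r t) f1 a1 a2 _ f2).
- now apply (chain F F1 (fun u => q u t) (fun u => Ar u t) r (Arr r t) f1 a1 a2 _ f2).
- now apply (chain F F1 (fun v => q r v) (fun v => At r v) t (Att r t) f1 a3 a4 _ f2).
- now apply (chain F F1 (fun v => q r v) (fun v => At r v) t (Att r t) f1 a3 a4 _ f2).
- now apply c0.
- apply continuity_2d_pt_mult; [now apply c0|assumption].
- apply continuity_2d_pt_plus; apply continuity_2d_pt_mult; auto.
- apply continuity_2d_pt_mult; auto.
- apply continuity_2d_pt_plus; apply continuity_2d_pt_mult; auto.
- cbv beta; now rewrite a9.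
- cbv beta; now rewrite a9, a10.
- reflexivity.
- cbv beta; rewrite a11, a12. ring.
Qed.

Lemma Cmod_circle_point r t : Cmod (circle_point r t) = Rabs r.
Proof.
rewrite <- (Rabs_pos_eq (Cmod _)) by apply Cmod_ge_0. apply Rsqr_eq_abs_0.
rewrite !Rsqr_pow2, Cmod2_alt. unfold circle_point, Re, Im; simpl fst; simpl snd.
generalize (sin2_cos2 t). unfold Rsqr. intros h. nra.
Qed.

Lemma in_disc_circle_point r t : -1 < r < 1 -> in_disc (circle_point r t).
Proof. intros hr. unfold in_disc. rewrite Cmod_circle_point. now apply Rabs_def1. Qed.

Lemma is_cderive_radius r t : is_cderive (fun u => circle_point u t) r (circle_point 1 t).
Proof.
split; unfold circle_point, Re, Im; simpl; auto_derive; auto; ring.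
Qed.

Lemma is_cderive_angle r t :
  is_cderive (fun v => circle_point r v) t (Ci * circle_point r t)%C.
Proof.
split; unfold circle_point, Re, Im; simpl; auto_derive; auto; ring.
Qed.

Lemma is_cderive_const c x : is_cderive (fun _ => c) x (RtoC 0).
Proof. split; apply (is_derive_const (V := R_NormedModule)). Qed.

Lemma ccont_2d_circle_point (p : R -> R -> R) r t :
  continuity_2d_pt p r t -> ccont_2d (fun u v => circle_point (p u v) v) r t.
Proof.
intros hp.
split; unfold circle_point, Re, Im; simpl; apply continuity_2d_pt_mult;
  try assumption; apply continuity_1d_2d_pt_comp;
  (apply continuity_cos || apply continuity_sin || apply continuity_2d_pt_id2).
Qed.

Lemma ccont_2d_const c r t : ccont_2d (fun _ _ => c) r t.
Proof. split; apply continuity_2d_pt_const. Qed.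

(** Twice complex differentiable with a continuous second derivative.  Solutions have
    this regularity by the equation [f'' = - A f] itself, without Cauchy's theory. *)
Definition holo2 (h h1 h2 : C -> C) : Prop :=
  deriv_on_disc h h1 /\ deriv_on_disc h1 h2 /\ (forall z, in_disc z -> Ccontinuous h2 z).

(** For holomorphic [h] the Laplacian of [|h| ^ 2] is [4 |h'| ^ 2] and the gradient of
    [|h| ^ 2] has square [4 |h| ^ 2 |h'| ^ 2]: the terms with [h''] cancel by the
    Cauchy-Riemann equations, here in the form that the angular derivative of [h] is [i z h']. *)
Lemma polar_C2_normsq (h h1 h2 : C -> C) :
  holo2 h h1 h2 ->
  polar_C2 (fun r t => Cmod (h (circle_point r t)) ^ 2)
    (fun r t => 4 * r ^ 2 * Cmod (h (circle_point r t)) ^ 2 * Cmod (h1 (circle_point r t)) ^ 2)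
    (fun r t => 4 * r ^ 2 * Cmod (h1 (circle_point r t)) ^ 2).
Proof.
intros (hh & hh1 & hh2).
set (hr := fun r t => (h1 (circle_point r t) * circle_point 1 t)%C).
set (hrr := fun r t => (h2 (circle_point r t) * circle_point 1 t * circle_point 1 t)%C).
set (ht := fun r t => (h1 (circle_point r t) * (Ci * circle_point r t))%C).
set (htt := fun r t => (h2 (circle_point r t) * (Ci * circle_point r t) * (Ci * circle_point r t)
  + h1 (circle_point r t) * (Ci * (Ci * circle_point r t)))%C).
set (H := fun r t => h (circle_point r t)).
exists (fun r t => 2 * dot (H r t) (hr r t)),
  (fun r t => 2 * (dot (hr r t) (hr r t) + dot (H r t) (hrr r t))),
  (fun r t => 2 * dot (H r t) (ht r t)),
  (fun r t => 2 * (dot (ht r t) (ht r t) + dot (H r t) (htt r t))).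
intros r t hrt.
assert (hz := in_disc_circle_point r t hrt).
assert (dr : is_cderive (fun u => H u t) r (hr r t)).
{ apply C_derive_along; [now apply hh|apply is_cderive_radius]. }
assert (dt : is_cderive (fun v => H r v) t (ht r t)).
{ apply C_derive_along; [now apply hh|apply is_cderive_angle]. }
assert (drr : is_cderive (fun u => hr u t) r (hrr r t)).
{ replace (hrr r t) with
  (h2 (circle_point r t) * circle_point 1 t * circle_point 1 t
    + h1 (circle_point r t) * RtoC 0)%C by (unfold hrr; ring).
  apply (is_cderive_mult (fun u => h1 (circle_point u t)) (fun _ => circle_point 1 t));
      [|apply is_cderive_const].
  apply C_derive_along; [now apply hh1|apply is_cderive_radius]. }
assert (dtt : is_cderive (fun v => ht r v) t (htt r t)).
{ apply (is_cderive_mult (fun v => h1 (circle_point r v)) (fun v => Ci * circle_point r v)%C).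
  - apply C_derive_along; [now apply hh1|apply is_cderive_angle].
  - replace (Ci * (Ci * circle_point r t))%C with
      (RtoC 0 * circle_point r t + Ci * (Ci * circle_point r t))%C by ring.
    apply (is_cderive_mult (fun _ => Ci) (fun v => circle_point r v));
        [apply is_cderive_const|apply is_cderive_angle]. }
assert (cz := ccont_2d_circle_point (fun u _ => u) r t (continuity_2d_pt_id1 r t)).
assert (c0 : ccont_2d H r t).
{ apply continuity_2d_comp_C; [|exact cz].
  now apply Ccontinuous_of_derive with (h1 (circle_point r t)), hh. }
assert (c1 : ccont_2d (fun r t => h1 (circle_point r t)) r t).
{ apply continuity_2d_comp_C; [|exact cz].
  now apply Ccontinuous_of_derive with (h2 (circle_point r t)), hh1. }
assert (c2 : ccont_2d (fun r t => h2 (circle_point r t)) r t).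
{ apply continuity_2d_comp_C; [|exact cz]. now apply hh2. }
assert (c3 : ccont_2d (fun _ t => circle_point 1 t) r t).
{ apply (ccont_2d_circle_point (fun _ _ => 1)), continuity_2d_pt_const. }
assert (c4 : ccont_2d (fun _ _ => Ci) r t) by apply ccont_2d_const.
assert (chr : ccont_2d hr r t) by now apply ccont_2d_mult.
assert (chrr : ccont_2d hrr r t) by now repeat apply ccont_2d_mult.
assert (cht : ccont_2d ht r t) by now repeat apply ccont_2d_mult.
assert (chtt : ccont_2d htt r t).
{ apply ccont_2d_plus; now repeat apply ccont_2d_mult. }
assert (dot_sym : forall z w, dot z w = dot w z) by (intros; unfold dot; ring).
assert (circle_period : circle_point r (2 * PI) = circle_point r 0).
{ unfold circle_point. now rewrite cos_2PI, sin_2PI, cos_0, sin_0. }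
assert (two : forall W : R -> R -> R, continuity_2d_pt W r t ->
  continuity_2d_pt (fun u v => 2 * W u v) r t).
{ intros W hW. apply continuity_2d_pt_mult; [apply continuity_2d_pt_const|exact hW]. }
split_conj.
- apply (is_derive_ext (fun u => dot (H u t) (H u t))); [intros; apply dot_self|].
  evar_last; [apply (is_derive_dot (fun u => H u t) (fun u => H u t)); exact dr|].
    rewrite (dot_sym (hr r t)). simpl. ring.
- apply (is_derive_scal (fun u => dot (H u t) (hr u t))).
  now apply (is_derive_dot (fun u => H u t) (fun u => hr u t)).
- apply (is_derive_ext (fun v => dot (H r v) (H r v))); [intros; apply dot_self|].
  evar_last; [apply (is_derive_dot (fun v => H r v) (fun v => H r v)); exact dt|].
    rewrite (dot_sym (ht r t)). simpl. ring.
- apply (is_derive_scal (fun v => dot (H r v) (ht r v))).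
  now apply (is_derive_dot (fun v => H r v) (fun v => ht r v)).
- apply (continuity_2d_pt_ext (fun u v => dot (H u v) (H u v))); [intros; apply dot_self|].
  now apply continuity_2d_dot.
- now apply two, continuity_2d_dot.
- apply two, continuity_2d_pt_plus; now apply continuity_2d_dot.
- now apply two, continuity_2d_dot.
- apply two, continuity_2d_pt_plus; now apply continuity_2d_dot.
- now rewrite circle_period.
- unfold ht, H. now rewrite circle_period.
- rewrite !Cmod2_alt. unfold hr, ht, H, circle_point.
  generalize (sin2_cos2 t); unfold Rsqr.
  destruct (h _) as [a b], (h1 _) as [c d].
  unfold dot, Re, Im, Ci, Cmult; simpl. intros e.
  transitivity (4 * r ^ 2 * (a ^ 2 + b ^ 2) * (c ^ 2 + d ^ 2) * (sin t * sin t + cos t * cos t));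
    [rewrite e|]; ring.
- rewrite !Cmod2_alt. unfold hr, hrr, ht, htt, H, circle_point.
  generalize (sin2_cos2 t); unfold Rsqr.
  destruct (h _) as [a b], (h1 _) as [c d], (h2 _) as [a2 b2].
  unfold dot, Re, Im, Ci, Cmult, Cplus; simpl. intros e.
  transitivity (4 * r ^ 2 * (c ^ 2 + d ^ 2) * (sin t * sin t + cos t * cos t)); [rewrite e|]; ring.
Qed.

(** * Disc automorphisms *)

Lemma in_disc_locally (z : C) : in_disc z ->
  locally (T := AbsRing_UniformSpace C_AbsRing) z in_disc.
Proof.
intros hz. unfold in_disc in *. assert (h : 0 < 1 - Cmod z) by lra.
exists (mkposreal _ h). intros w hw. unfold ball in hw; simpl in hw.
unfold AbsRing_ball, abs, minus, plus, opp in hw; simpl in hw.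
replace w with ((w + - z) + z)%C by ring.
apply Rle_lt_trans with (1 := Cmod_triangle _ _). lra.
Qed.

(** A quadratic remainder on the whole disc gives the derivative without any limit argument;
    this is what the geometric kernel satisfies. *)
Lemma is_derive_C_quadratic (h : C -> C) (z d : C) (K : R) :
  in_disc z ->
  (forall y, in_disc y -> Cmod (h y - h z - (y - z) * d)%C <= K * Cmod (y - z)%C ^ 2) ->
  is_derive (K := C_AbsRing) (V := C_NormedModule) h z d.
Proof.
intros hz H. split; [apply is_linear_scal_l|].
intros x hx.
assert (hx' : z = x).
{ apply (is_filter_lim_locally_unique (V := AbsRing_NormedModule C_AbsRing)). exact hx. }
subst x. intros eps.
assert (hK : 0 < eps / (Rabs K + 1)).
{ apply Rdiv_lt_0_compat; [apply eps|]. pose proof (Rabs_pos K). lra. }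
generalize (filter_and _ _ (in_disc_locally z hz)
  (locally_ball (T := AbsRing_UniformSpace C_AbsRing) z (mkposreal _ hK))).
apply filter_imp. intros y [hy hb].
change (Cmod (h y - h z - (y - z) * d)%C <= eps * Cmod (y - z)%C).
apply Rle_trans with (1 := H y hy).
change (Cmod (y - z)%C < eps / (Rabs K + 1)) in hb.
pose proof (Cmod_ge_0 (y - z)%C). pose proof (Rle_abs K). pose proof (Rabs_pos K).
assert (hb' : (Rabs K + 1) * Cmod (y - z)%C <= eps).
{ apply Rmult_lt_compat_l with (r := Rabs K + 1) in hb; [|lra].
  replace ((Rabs K + 1) * (eps / (Rabs K + 1))) with (pos eps) in hb by (field; lra). lra. }
nra.
Qed.

Definition kern (c z : C) : C := (/ (RtoC 1 - c * z))%C.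

Lemma one_minus_Cmod c z : in_disc c -> in_disc z -> 1 - Cmod c <= Cmod (RtoC 1 - c * z)%C.
Proof.
unfold in_disc. intros hc hz.
assert (h : Cmod (RtoC 1) <= Cmod (RtoC 1 - c * z)%C + Cmod (c * z)%C).
{ apply Rle_trans with (2 := Cmod_triangle _ _). apply Req_le. f_equal. ring. }
rewrite Cmod_1, Cmod_mult in h.
pose proof (Cmod_ge_0 c). pose proof (Cmod_ge_0 z). nra.
Qed.

Lemma one_minus_neq_0 c z : in_disc c -> in_disc z -> (RtoC 1 - c * z)%C <> RtoC 0.
Proof.
intros hc hz h. assert (k := one_minus_Cmod c z hc hz). rewrite h, Cmod_0 in k.
unfold in_disc in hc. lra.
Qed.

Lemma kern_derive c z : in_disc c -> in_disc z ->
  is_derive (K := C_AbsRing) (V := C_NormedModule) (kern c) z (c * kern c z * kern c z)%C.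
Proof.
intros hc hz.
apply is_derive_C_quadratic with (Cmod c ^ 2 * Cmod (kern c z) ^ 2 * / (1 - Cmod c)); [exact hz|].
intros y hy.
assert (n1 := one_minus_neq_0 c z hc hz). assert (n2 := one_minus_neq_0 c y hc hy).
replace (kern c y - kern c z - (y - z) * (c * kern c z * kern c z))%C
  with ((y - z) * (y - z) * (c * c) * (kern c z * kern c z) * kern c y)%C
  by (unfold kern; field; split; assumption).
rewrite !Cmod_mult.
assert (k : Cmod (kern c y) <= / (1 - Cmod c)).
{ unfold kern. rewrite Cmod_inv by exact n2. apply Rinv_le_contravar.
  - unfold in_disc in hc. lra.
  - now apply one_minus_Cmod. }
replace (Cmod c ^ 2 * Cmod (kern c z) ^ 2 * / (1 - Cmod c) * Cmod (y - z) ^ 2)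
  with (Cmod (y - z) * Cmod (y - z) * (Cmod c * Cmod c) *
    (Cmod (kern c z) * Cmod (kern c z)) * / (1 - Cmod c)) by ring.
apply Rmult_le_compat_l with (2 := k).
repeat apply Rmult_le_pos; apply Cmod_ge_0.
Qed.

Lemma is_derive_C_mult (f g : C -> C) (z df dg : C) :
  is_derive (K := C_AbsRing) (V := C_NormedModule) f z df ->
  is_derive (K := C_AbsRing) (V := C_NormedModule) g z dg ->
  is_derive (K := C_AbsRing) (V := C_NormedModule) (fun w => f w * g w)%C z
    (df * g z + f z * dg)%C.
Proof.
rewrite !is_derive_C_AbsRing.
intros hf hg. exact (is_derive_mult (K := C_AbsRing) f g z df dg hf hg Cmult_comm).
Qed.

Lemma is_derive_C_plus (f g : C -> C) (z df dg : C) :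
  is_derive (K := C_AbsRing) (V := C_NormedModule) f z df ->
  is_derive (K := C_AbsRing) (V := C_NormedModule) g z dg ->
  is_derive (K := C_AbsRing) (V := C_NormedModule) (fun w => f w + g w)%C z (df + dg)%C.
Proof. rewrite !is_derive_C_AbsRing. intros hf hg.
  exact (is_derive_plus (K := C_AbsRing) (V := AbsRing_NormedModule C_AbsRing)
      f g z df dg hf hg). Qed.

Lemma is_derive_C_const (c z : C) :
  is_derive (K := C_AbsRing) (V := C_NormedModule) (fun _ => c) z (RtoC 0).
Proof. exact (is_derive_const (K := C_AbsRing) (V := C_NormedModule) c z). Qed.

Lemma is_derive_C_comp (f g : C -> C) (z df dg : C) :
  is_derive (K := C_AbsRing) (V := C_NormedModule) f (g z) df ->
  is_derive (K := C_AbsRing) (V := C_NormedModule) g z dg ->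
  is_derive (K := C_AbsRing) (V := C_NormedModule) (fun w => f (g w)) z (df * dg)%C.
Proof.
rewrite !is_derive_C_AbsRing. intros hf hg. rewrite Cmult_comm.
exact (is_derive_comp (K := C_AbsRing) (V := AbsRing_NormedModule C_AbsRing) f g z df dg hf hg).
Qed.

Lemma is_derive_C_id (z : C) :
  is_derive (K := C_AbsRing) (V := C_NormedModule) (fun w => w) z (RtoC 1).
Proof. rewrite is_derive_C_AbsRing. exact (is_derive_id (K := C_AbsRing) z). Qed.

Lemma Ccontinuous_plus f g z :
  Ccontinuous f z -> Ccontinuous g z -> Ccontinuous (fun w => f w + g w)%C z.
Proof.
exact (continuous_plus (U := AbsRing_UniformSpace C_AbsRing)
  (V := AbsRing_NormedModule C_AbsRing) f g z).
Qed.

Lemma Ccontinuous_mult f g z :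
  Ccontinuous f z -> Ccontinuous g z -> Ccontinuous (fun w => f w * g w)%C z.
Proof.
exact (continuous_mult (U := AbsRing_UniformSpace C_AbsRing) (K := C_AbsRing) f g z).
Qed.

Lemma Ccontinuous_comp f g z :
  Ccontinuous f (g z) -> Ccontinuous g z -> Ccontinuous (fun w => f (g w)) z.
Proof. intros hf hg. exact (continuous_comp (U := AbsRing_UniformSpace C_AbsRing)
  (V := AbsRing_UniformSpace C_AbsRing) (W := AbsRing_UniformSpace C_AbsRing) g f z hg hf). Qed.

Lemma holo2_comp f f1 f2 g g1 g2 :
  holo2 f f1 f2 -> holo2 g g1 g2 -> (forall z, in_disc z -> in_disc (g z)) ->
  holo2 (fun z => f (g z)) (fun z => f1 (g z) * g1 z)%C
    (fun z => f2 (g z) * g1 z * g1 z + f1 (g z) * g2 z)%C.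
Proof.
intros (a & a1 & a2) (b & b1 & b2) hg.
split; [|split]; intros z hz.
- apply (is_derive_C_comp f g); auto.
- apply (is_derive_C_mult (fun w => f1 (g w)) g1); [|auto]. apply (is_derive_C_comp f1 g); auto.
- assert (c0 : Ccontinuous g z) by (eapply Ccontinuous_of_derive; auto).
  assert (c1 : Ccontinuous g1 z) by (eapply Ccontinuous_of_derive; auto).
  assert (c2 : Ccontinuous f1 (g z)) by (eapply Ccontinuous_of_derive; auto).
  apply Ccontinuous_plus; [apply (Ccontinuous_mult (fun z => f2 (g z) * g1 z)%C)|];
    try apply Ccontinuous_mult; auto; apply Ccontinuous_comp; auto.
Qed.

Lemma holo2_minus_const f f1 f2 c : holo2 f f1 f2 -> holo2 (fun z => f z - c)%C f1 f2.
Proof.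
intros (a & a1 & a2). split; [|split]; [|assumption..].
intros z hz. replace (f1 z) with (f1 z + RtoC 0)%C by ring.
apply is_derive_C_plus; [now apply a|apply is_derive_C_const].
Qed.

Lemma holo2_phi a : in_disc a -> exists p1 p2, holo2 (phi a) p1 p2.
Proof.
intros ha.
set (c := Cconj a).
assert (hc : in_disc c) by (unfold in_disc, c; now rewrite Cmod_conj).
assert (dk := fun z => kern_derive c z hc).
set (k1 := fun z => (c * kern c z * kern c z)%C).
set (k2 := fun z => (c * k1 z * kern c z + c * kern c z * k1 z)%C).
assert (dk1 : forall z, in_disc z -> is_derive (K := C_AbsRing) (V := C_NormedModule) k1 z (k2 z)).
{ intros z hz. apply (is_derive_C_mult (fun z => c * kern c z)%C); [|now apply dk].
  replace (c * k1 z)%C with (RtoC 0 * kern c z + c * k1 z)%C by ring.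
  apply (is_derive_C_mult (fun _ => c)); [apply is_derive_C_const|now apply dk]. }
set (l := fun z => (a + RtoC (-1) * z)%C).
assert (dl : forall z, is_derive (K := C_AbsRing) (V := C_NormedModule) l z (RtoC (-1))).
{ intros z. replace (RtoC (-1)) with (RtoC 0 + (RtoC 0 * z + RtoC (-1) * RtoC 1))%C by ring.
  apply is_derive_C_plus; [apply is_derive_C_const|].
  apply (is_derive_C_mult (fun _ => RtoC (-1))); [apply is_derive_C_const|apply is_derive_C_id]. }
exists (fun z => RtoC (-1) * kern c z + l z * k1 z)%C.
exists (fun z => (RtoC 0 * kern c z + RtoC (-1) * k1 z) + (RtoC (-1) * k1 z + l z * k2 z))%C.
split; [|split]; intros z hz.
- apply (is_derive_ext (K := C_AbsRing) (V := C_NormedModule) (fun z => l z * kern c z)%C).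
  { intros w. unfold l, phi, Cdiv, kern, Cminus. fold c. f_equal. f_equal.
    unfold Cmult, RtoC, Copp; simpl. f_equal; ring. }
  apply is_derive_C_mult; [apply dl|now apply dk].
- apply is_derive_C_plus; apply is_derive_C_mult; auto. apply is_derive_C_const.
- assert (c1 : Ccontinuous k1 z) by (eapply Ccontinuous_of_derive; auto).
  assert (c0 : Ccontinuous (kern c) z) by (eapply Ccontinuous_of_derive; auto).
  assert (cl : Ccontinuous l z) by (eapply Ccontinuous_of_derive; auto).
  assert (cc : forall c, Ccontinuous (fun _ => c) z) by
    (intros; exact (@continuous_const (AbsRing_UniformSpace C_AbsRing)
        (AbsRing_UniformSpace C_AbsRing) _ z)).
  unfold k2.
  repeat match goal with
  | |- Ccontinuous (fun w => Cplus (@?f w) (@?g w)) _ => apply (Ccontinuous_plus f g)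
  | |- Ccontinuous (fun w => Cmult (@?f w) (@?g w)) _ => apply (Ccontinuous_mult f g)
  | |- Ccontinuous (fun _ => ?c) _ => apply (cc c)
  | _ => assumption
  end.
Qed.

(** The identity that makes [phi a] a self-map of the disc. *)
Lemma one_minus_normsq_phi a z : in_disc a -> in_disc z ->
  1 - Cmod (phi a z) ^ 2 =
  (1 - Cmod a ^ 2) * (1 - Cmod z ^ 2) / Cmod (RtoC 1 - Cconj a * z)%C ^ 2.
Proof.
intros ha hz.
assert (hn : (RtoC 1 - Cconj a * z)%C <> RtoC 0).
{ apply one_minus_neq_0; [|exact hz]. unfold in_disc. now rewrite Cmod_conj. }
unfold phi. rewrite Cmod_div by exact hn.
assert (hm : 0 < Cmod (RtoC 1 - Cconj a * z)%C) by now apply Cmod_gt_0.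
assert (e : Cmod (a - z)%C ^ 2 = Cmod (RtoC 1 - Cconj a * z)%C ^ 2
  - (1 - Cmod a ^ 2) * (1 - Cmod z ^ 2)).
{ rewrite !Cmod2_alt. destruct a, z. unfold Re, Im, Cminus, Cconj, Cmult, Cplus, Copp, RtoC;
    simpl. ring. }
apply Rmult_eq_reg_r with (Cmod (RtoC 1 - Cconj a * z)%C ^ 2); [|nra].
unfold Rdiv at 1. rewrite Rpow_mult_distr, e.
field. lra.
Qed.

Lemma in_disc_phi a z : in_disc a -> in_disc z -> in_disc (phi a z).
Proof.
intros ha hz. assert (e := one_minus_normsq_phi a z ha hz).
assert (hn : (RtoC 1 - Cconj a * z)%C <> RtoC 0).
{ apply one_minus_neq_0; [|exact hz]. unfold in_disc. now rewrite Cmod_conj. }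
apply Cmod_gt_0 in hn. unfold in_disc in *.
pose proof (Cmod_ge_0 a). pose proof (Cmod_ge_0 z). pose proof (Cmod_ge_0 (phi a z)).
assert (0 < (1 - Cmod a ^ 2) * (1 - Cmod z ^ 2) / Cmod (RtoC 1 - Cconj a * z)%C ^ 2).
{ apply Rdiv_lt_0_compat; [|nra]. apply Rmult_lt_0_compat; nra. }
nra.
Qed.

Lemma phi_0 a : phi a (RtoC 0) = a.
Proof.
unfold phi. replace (RtoC 1 - Cconj a * RtoC 0)%C with (RtoC 1) by ring.
replace (a - RtoC 0)%C with a by ring. field.
Qed.

(** * Radial comparison functions and VMOA *)

Lemma nondecreasing_bounded_limit (J : R -> R) (B : R) :
  (forall r s, 0 <= r -> r <= s -> s < 1 -> J r <= J s) ->
  (forall r, 0 <= r < 1 -> J r <= B) ->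
  exists l, filterlim J (at_left 1) (locally l) /\ l <= B /\ forall r, 0 <= r < 1 -> J r <= l.
Proof.
intros hJ hB.
destruct (completeness (fun y => exists r, 0 <= r < 1 /\ y = J r)) as [l [hl1 hl2]].
- exists B. intros y (r & hr & ->). now apply hB.
- exists (J 0), 0. split; [lra|reflexivity].
- assert (hl : forall r, 0 <= r < 1 -> J r <= l).
  { intros r hr. apply hl1. now exists r. }
  exists l. split; [|split; [|exact hl]].
  + apply filterlim_locally. intros eps.
    destruct (Classical_Prop.classic (exists r, 0 <= r < 1 /\ l - eps < J r))
        as [(r & hr & hlr)|hn].
    * assert (h1 : 0 < 1 - r) by lra.
      exists (mkposreal _ h1). intros s hs hs1.
      apply Rabs_lt_between' in hs. simpl in hs.
      assert (J r <= J s) by (apply hJ; lra).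
      assert (J s <= l) by (apply hl; lra).
      apply Rabs_lt_between'. pose proof (cond_pos eps). lra.
    * exfalso. assert (l <= l - eps); [|pose proof (cond_pos eps); lra].
      apply hl2. intros y (r & hr & ->). apply Rnot_lt_le. intros h. apply hn. now exists r.
  + apply hl2. intros y (r & hr & ->). now apply hB.
Qed.

Lemma polar_C2_ex_RInt V g l r :
  polar_C2 V g l -> -1 < r < 1 -> ex_RInt (V r) 0 (2 * PI).
Proof.
intros (Vr & Vrr & Vt & Vtt & H) hr.
apply (ex_RInt_continuous (V := R_CompleteNormedModule)). intros t _.
now apply continuity_2d_slice, H.
Qed.

Lemma circle_point_0 t : circle_point 0 t = RtoC 0.
Proof. unfold circle_point, RtoC. now rewrite !Rmult_0_l. Qed.

(** The hypothesis on [f1] says that the radial function [F (|w| ^ 2)] has a Laplacian at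
    least [4 |f'| ^ 2], the Laplacian of [|f - f a| ^ 2].  The difference
    [F (|w| ^ 2) - |f w - f a| ^ 2] is then subharmonic, and remains so after composition with
    [phi a]; comparing its value at [0] with its mean over a circle gives
    [mean_sq r (hyp_translate f a) <= L - F (|a| ^ 2)] with [L] the limit of [F] at [1].  The
    right side tends to [0] as [|a|] tends to [1].  The means have a limit at [1] because
    [|hyp_translate f a| ^ 2] is itself subharmonic, so that they increase. *)
Lemma VMOA_of_radial_majorant (f f1 f2 : C -> C) (F F1 F2 : R -> R) (S : R) :
  holo2 f f1 f2 ->
  (forall x, 0 <= x < 1 ->
    is_derive F x (F1 x) /\ is_derive F1 x (F2 x) /\ continuous F2 x) ->
  (forall x, 0 <= x < 1 -> 0 <= F1 x) ->
  (forall x, 0 <= x < 1 -> F x <= S) ->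
  (forall w, in_disc w -> Cmod (f1 w) ^ 2 <= F1 (Cmod w ^ 2) + Cmod w ^ 2 * F2 (Cmod w ^ 2)) ->
  VMOA f.
Proof.
intros hf hF hF1 hS hmaj.
split.
{ intros z hz. exists (f1 z). now apply hf. }
intros eps heps.
assert (hPI := PI_RGT_0).
assert (hFmono : forall x y, 0 <= x -> x <= y -> y < 1 -> F x <= F y).
{ intros x y hx hxy hy. apply (nondecreasing_of_derive F F1); [exact hxy| |].
  - intros u hu. apply hF. lra.
  - intros u hu. apply hF1. lra. }
destruct (nondecreasing_bounded_limit F S hFmono hS) as (L & hL & _ & hFL).
assert (hx0 : exists x0, 0 <= x0 < 1 /\ L - eps / 2 < F x0).
{ assert (he : 0 < eps / 2) by lra.
  assert (hloc := proj1 (filterlim_locally F L) hL (mkposreal _ he)).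
  destruct hloc as [d hd].
  pose proof (cond_pos d).
  exists (Rmax 0 (1 - d / 2)).
  assert (0 <= Rmax 0 (1 - d / 2) < 1).
  { split; [apply Rmax_l|]. apply Rmax_lub_lt; lra. }
  split; [assumption|].
  assert (hb : ball L (eps / 2) (F (Rmax 0 (1 - d / 2)))).
  { apply hd; [|lra]. apply Rabs_lt_between'.
    pose proof (Rmax_r 0 (1 - d / 2)). lra. }
  apply Rabs_lt_between' in hb. lra. }
destruct hx0 as (x0 & hx0 & hFx0).
exists (sqrt x0). split.
{ rewrite <- sqrt_1. apply sqrt_lt_1; lra. }
intros a [ha1 ha2].
assert (ha : in_disc a) by exact ha2.
assert (hqa : x0 <= Cmod a ^ 2 < 1).
{ pose proof (sqrt_pos x0). pose proof (Cmod_ge_0 a).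
  rewrite <- (sqrt_sqrt x0) by lra. nra. }
assert (hFa : L - eps / 2 < F (Cmod a ^ 2)).
{ apply Rlt_le_trans with (1 := hFx0). apply hFmono; lra. }
destruct (holo2_phi a ha) as (p1 & p2 & hp).
assert (hg := holo2_minus_const _ _ _ (f a)
  (holo2_comp _ _ _ _ _ _ hf hp (fun z => in_disc_phi a z ha))).
assert (hV := polar_C2_normsq _ _ _ hg).
assert (hQ := polar_C2_normsq _ _ _ hp).
set (V := fun r t => Cmod (f (phi a (circle_point r t)) - f a)%C ^ 2) in *.
set (Q := fun r t => Cmod (phi a (circle_point r t)) ^ 2) in *.
assert (hQ1 : forall r t, -1 < r < 1 -> 0 <= Q r t < 1).
{ intros r t hr. assert (hd := in_disc_phi a _ ha (in_disc_circle_point r t hr)).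
  unfold in_disc in hd. unfold Q. pose proof (Cmod_ge_0 (phi a (circle_point r t))). nra. }
destruct (polar_C2_comp F F1 F2 Q _ _ hF hQ1 hQ) as [gF hFQ].
destruct (polar_C2_minus _ _ _ _ _ _ hFQ hV) as [gW hW].
assert (monoV := circle_integral_nondecreasing V _ _ hV).
assert (monoW := circle_integral_nondecreasing _ _ _ hW).
assert (monoV' : forall r s, 0 <= r -> r <= s -> s < 1 ->
    RInt (V r) 0 (2 * PI) <= RInt (V s) 0 (2 * PI)).
{ apply monoV. intros r t hr. pose proof (pow2_ge_0 r).
  pose proof (pow2_ge_0 (Cmod (f1 (phi a (circle_point r t)) * p1 (circle_point r t)))). nra. }
assert (hbound : forall r, 0 <= r < 1 -> RInt (V r) 0 (2 * PI) <= 2 * PI * (eps / 2)).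
{ intros r hr.
  assert (k : RInt (fun t => F (Q 0 t) - V 0 t) 0 (2 * PI)
     <= RInt (fun t => F (Q r t) - V r t) 0 (2 * PI)).
  { apply monoW; [|lra|lra|lra]. intros s t hs.
    assert (hs' : -1 < s < 1) by lra.
    assert (hm := hmaj _ (in_disc_phi a _ ha (in_disc_circle_point s t hs'))).
    fold (Q s t) in hm. rewrite Cmod_mult, Rpow_mult_distr. fold (Q s t).
    pose proof (pow2_ge_0 s). pose proof (pow2_ge_0 (Cmod (p1 (circle_point s t)))).
    assert (0 <= s ^ 2 * Cmod (p1 (circle_point s t)) ^ 2) by nra.
    nra. }
  rewrite (RInt_ext _ (fun _ => F (Cmod a ^ 2))) in k.
  2:{ intros t _. unfold Q, V. rewrite circle_point_0, phi_0.
      replace (f a - f a)%C with (RtoC 0) by ring. rewrite Cmod_0. simpl. ring. }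
  rewrite RInt_const in k. set (FA := F (Cmod a ^ 2)) in *. unfold scal in k; simpl in k;
      unfold mult in k; simpl in k.
  assert (iF := polar_C2_ex_RInt _ _ _ r hFQ ltac:(lra)).
  assert (iV := polar_C2_ex_RInt _ _ _ r hV ltac:(lra)). fold (V r) in iV.
  assert (e : RInt (fun t => F (Q r t) - V r t) 0 (2 * PI) =
     RInt (fun t => F (Q r t)) 0 (2 * PI) - RInt (V r) 0 (2 * PI)).
  { apply (RInt_minus (V := R_CompleteNormedModule) (fun t => F (Q r t)) (V r)); assumption. }
  rewrite e in k.
  assert (k2 : RInt (fun t => F (Q r t)) 0 (2 * PI) <= RInt (fun _ => L) 0 (2 * PI)).
  { apply RInt_le; [lra|exact iF|apply ex_RInt_const|].
    intros t _. apply hFL, hQ1. lra. }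
  rewrite RInt_const in k2. unfold scal in k2; simpl in k2; unfold mult in k2; simpl in k2.
  assert (kk := Rmult_lt_compat_l PI _ _ hPI hFa). lra. }
destruct (nondecreasing_bounded_limit (fun r => mean_sq r (hyp_translate f a)) (eps / 2))
  as (l & hl & hle & _).
- intros r s hr hrs hs. unfold mean_sq, hyp_translate.
  apply Rmult_le_compat_l; [left; apply Rinv_0_lt_compat; lra|]. now apply monoV'.
- intros r hr. unfold mean_sq, hyp_translate.
  apply Rmult_le_reg_l with (2 * PI); [lra|].
  rewrite <- Rmult_assoc, Rinv_r, Rmult_1_l by lra. now apply hbound.
- exists l. split; [exact hl|lra].
Qed.

Lemma is_derive_RInt_0 (k : R -> R) (x : R) :
  (forall y, -1 < y < 1 -> continuous k y) -> -1 < x < 1 ->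
  is_derive (RInt k 0) x (k x).
Proof.
intros hk hx.
apply (is_derive_RInt (V := R_NormedModule) k (RInt k 0) 0); [|now apply hk].
generalize (open_interval_locally x hx). apply filter_imp. intros y hy.
apply (RInt_correct (V := R_CompleteNormedModule)).
apply (ex_RInt_continuous (V := R_CompleteNormedModule)). intros z hz. apply hk.
pose proof (Rmin_glb_lt 0 y (-1)). pose proof (Rmax_lub_lt 0 y 1). lra.
Qed.

Lemma is_derive_primitive (k : R -> R) (c x : R) :
  (forall y, -1 < y < 1 -> continuous k y) -> -1 < x < 1 ->
  is_derive (fun y => c + RInt k 0 y) x (k x).
Proof.
intros hk hx.
evar_last.
- apply (is_derive_plus (V := R_NormedModule)); [|now apply is_derive_RInt_0].
  apply (is_derive_const (V := R_NormedModule)).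
- unfold plus, zero; simpl. ring.
Qed.

Lemma RInt_0_0 (k : R -> R) : RInt k 0 0 = 0.
Proof. exact (RInt_point 0 k). Qed.

Lemma primitive_0 (k : R -> R) (c : R) : c + RInt k 0 0 = c.
Proof. rewrite RInt_0_0. ring. Qed.

Lemma continuous_of_is_derive (f : R -> R) (x l : R) : is_derive f x l -> continuous f x.
Proof. intros h. apply (ex_derive_continuous (V := R_NormedModule)). now exists l. Qed.

(** With [D] a bound for [|f'|], [F] is obtained by integrating [F'' x = 4 D (sqrt x) ^ 2]
    twice: then [x F'' >= D ^ 2] for [x >= 1 / 4], and the constant [F' 0 = D (1 / 2) ^ 2] takes
    care of [x <= 1 / 4].  That [F] is bounded is a Hardy inequality, the integrability of
    [D' ^ 2 (1 - r) ^ 3] implying that of [D ^ 2 (1 - r)].  It is proved in differential form: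
    with [P] the integral of [D' ^ 2 (1 - r) ^ 3], the function
    [F (r ^ 2) + (1 - r ^ 2) F' (r ^ 2) + 16 D ^ 2 (1 - r) ^ 2 - 16 P] is nonincreasing, since
    its derivative is at most [- 16 (1 - r) (D - D' (1 - r)) ^ 2]. *)
Lemma radial_majorant (p : R -> R) (c B : R) :
  let D := fun r => c + RInt p 0 r in
  (forall x, -1 < x < 1 -> continuous p x) ->
  (forall x, 0 <= x < 1 -> 0 <= p x) -> 0 <= c ->
  (forall r, 0 <= r < 1 -> RInt (fun s => p s ^ 2 * (1 - s) ^ 3) 0 r <= B) ->
  exists (F F1 F2 : R -> R) (S : R),
    (forall x, 0 <= x < 1 ->
      is_derive F x (F1 x) /\ is_derive F1 x (F2 x) /\ continuous F2 x) /\
    (forall x, 0 <= x < 1 -> 0 <= F1 x) /\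
    (forall x, 0 <= x < 1 -> F x <= S) /\
    (forall r, 0 <= r < 1 -> D r ^ 2 <= F1 (r ^ 2) + r ^ 2 * F2 (r ^ 2)).
Proof.
intros D hp hp0 hc hB.
assert (hD : forall x, -1 < x < 1 -> is_derive D x (p x)).
{ intros x hx. now apply is_derive_primitive. }
assert (hD0 : D 0 = c) by apply primitive_0.
assert (hDmono : forall x y, 0 <= x -> x <= y -> y < 1 -> D x <= D y).
{ intros x y hx hxy hy. apply (nondecreasing_of_derive D p); [exact hxy| |].
  - intros u hu. apply hD. lra.
  - intros u hu. apply hp0. lra. }
assert (hDpos : forall x, 0 <= x < 1 -> 0 <= D x).
{ intros x hx. apply Rle_trans with (D 0); [lra|]. apply hDmono; lra. }
set (G := fun s => 4 * D (sqrt s) ^ 2).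
set (K := D (1 / 2) ^ 2).
set (F1 := fun x => K + RInt G 0 x).
set (F := RInt F1 0).
assert (hsqrt : forall s, -1 < s < 1 -> 0 <= sqrt s < 1).
{ intros s hs. split; [apply sqrt_pos|]. destruct (Rle_dec 0 s) as [h|h].
  - rewrite <- sqrt_1. apply sqrt_lt_1; lra.
  - rewrite sqrt_neg_0; lra. }
assert (hG : forall x, -1 < x < 1 -> continuous G x).
{ intros x hx. unfold G.
  apply (continuous_comp sqrt (fun r => 4 * D r ^ 2)); [apply continuous_sqrt|].
  assert (d := hD (sqrt x) ltac:(specialize (hsqrt x hx); lra)).
  eapply continuous_of_is_derive. auto_derive; [|reflexivity]. now exists (p (sqrt x)). }
assert (hG0 : forall x, 0 <= G x).
{ intros x. unfold G. pose proof (pow2_ge_0 (D (sqrt x))). lra. }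
assert (dF1 : forall x, -1 < x < 1 -> is_derive F1 x (G x)).
{ intros x hx. now apply is_derive_primitive. }
assert (dF : forall x, -1 < x < 1 -> is_derive F x (F1 x)).
{ intros x hx. apply is_derive_RInt_0; [|exact hx].
  intros y hy. eapply continuous_of_is_derive. now apply dF1. }
assert (hF1K : forall x, 0 <= x < 1 -> K <= F1 x).
{ intros x hx. rewrite <- (primitive_0 G K).
  apply (nondecreasing_of_derive F1 G 0 x); [lra| |].
  - intros u hu. apply dF1. lra.
  - intros u hu. apply hG0. }
assert (hK : 0 <= K) by apply pow2_ge_0.
set (P := RInt (fun s => p s ^ 2 * (1 - s) ^ 3) 0).
assert (hP : forall x, -1 < x < 1 -> is_derive P x (p x ^ 2 * (1 - x) ^ 3)).
{ intros x hx. apply (is_derive_RInt_0 (fun s => p s ^ 2 * (1 - s) ^ 3)); [|exact hx].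
  intros y hy. apply (continuous_mult (K := R_AbsRing) (fun s => p s ^ 2) (fun s => (1 - s) ^ 3)).
  - apply (continuous_comp p (fun v => v ^ 2)); [now apply hp|].
    eapply continuous_of_is_derive. auto_derive; [exact I|reflexivity].
  - eapply continuous_of_is_derive. auto_derive; [exact I|reflexivity]. }
exists F, F1, G, (K + 16 * c ^ 2 + 16 * B).
split; [|split; [|split]].
- intros x hx. split; [|split]; [apply dF|apply dF1|apply hG]; lra.
- intros x hx. specialize (hF1K x hx). lra.
- intros x hx.
  set (T := fun r => F (r ^ 2) + (1 - r ^ 2) * F1 (r ^ 2) + 16 * (D r ^ 2 * (1 - r) ^ 2)
      - 16 * P r).
  set (T' := fun r => (1 - r ^ 2) * (G (r ^ 2) * (2 * r))
     + 16 * (2 * D r * p r * (1 - r) ^ 2 - 2 * D r ^ 2 * (1 - r)) - 16 * (p r ^ 2 * (1 - r) ^ 3)).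
  assert (hsx := hsqrt x ltac:(lra)).
  assert (hT : - T 0 <= - T (sqrt x)).
  { apply (nondecreasing_of_derive (fun r => - T r) (fun r => - T' r)); [lra| |].
    - intros r hr. assert (hr2 : -1 < r ^ 2 < 1) by nra.
      assert (e1 := dF _ hr2). assert (e2 := dF1 _ hr2).
      assert (e3 := hD r ltac:(lra)). assert (e4 := hP r ltac:(lra)).
      clearbody F F1 D P. unfold T. auto_derive.
      + repeat split; try (eexists; eassumption).
      + change (fun x0 : R => D x0) with D. change (fun x0 : R => P x0) with P.
        change (fun x0 : R => F x0) with F. change (fun x0 : R => F1 x0) with F1.
        rewrite (is_derive_unique _ _ _ e3), (is_derive_unique _ _ _ e4).
        replace (r * (r * 1)) with (r ^ 2) by ring.
        rewrite (is_derive_unique _ _ _ e1), (is_derive_unique _ _ _ e2).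
        unfold T'. ring.
    - intros r hr. unfold T', G. rewrite sqrt_pow2 by lra.
      (* [- T'] is the sum of the two nonnegative terms below. *)
      assert (0 <= 16 * (1 - r) * (D r - p r * (1 - r)) ^ 2).
      { apply Rmult_le_pos; [lra|apply pow2_ge_0]. }
      assert (0 <= (1 - r) * (8 * (2 - r * (1 + r))) * D r ^ 2).
      { apply Rmult_le_pos; [|apply pow2_ge_0]. apply Rmult_le_pos; [lra|]. nra. }
      nra. }
  unfold T in hT. rewrite pow2_sqrt in hT by lra.
  assert (hPx := hB _ hsx). change (P (sqrt x) <= B) in hPx.
  assert (0 <= (1 - x) * F1 x).
  { apply Rmult_le_pos; [lra|]. specialize (hF1K x hx). lra. }
  assert (0 <= D (sqrt x) ^ 2 * (1 - sqrt x) ^ 2).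
  { apply Rmult_le_pos; apply pow2_ge_0. }
  assert (hT0 : F (0 ^ 2) + (1 - 0 ^ 2) * F1 (0 ^ 2) + 16 * (D 0 ^ 2 * (1 - 0) ^ 2) - 16 * P 0
    = K + 16 * c ^ 2).
  { replace (0 ^ 2) with 0 by ring. rewrite hD0. unfold F, F1, P.
    rewrite primitive_0, !RInt_0_0. ring. }
  lra.
- intros r hr. unfold G. rewrite sqrt_pow2 by lra.
  specialize (hF1K (r ^ 2) ltac:(nra)).
  pose proof (pow2_ge_0 (D r)). pose proof (pow2_ge_0 r).
  destruct (Rle_dec r (1 / 2)) as [h|h].
  + assert (D r <= D (1 / 2)) by (apply hDmono; lra).
    specialize (hDpos r hr).
    assert (D r ^ 2 <= K) by (unfold K; apply pow_incr; lra). nra.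
  + assert (1 <= 4 * r ^ 2) by nra. nra.
Qed.

(** * The maximum modulus *)

Lemma polar_form (z : C) : exists t, 0 <= t <= 2 * PI /\ z = circle_point (Cmod z) t.
Proof.
assert (hPI := PI_RGT_0).
destruct (Req_dec (Cmod z) 0) as [h0|h0].
{ exists 0. split; [lra|]. rewrite (Cmod_eq_0 z h0), Cmod_0. now rewrite circle_point_0. }
set (r := Cmod z) in *. assert (hr : 0 < r) by (pose proof (Cmod_ge_0 z); unfold r in *; lra).
assert (e : r ^ 2 = Re z ^ 2 + Im z ^ 2) by apply Cmod2_alt.
set (x := Re z / r).
assert (hxr : Re z = r * x) by (unfold x; field; lra).
assert (hx : -1 <= x <= 1).
{ rewrite hxr in e. pose proof (pow2_ge_0 (Im z)).
  assert (hx2 : x ^ 2 <= 1).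
  { apply Rmult_le_reg_l with (r ^ 2); [now apply pow_lt|]. nra. }
  nra. }
assert (hs : r * sqrt (1 - x * x) = Rabs (Im z)).
{ rewrite <- sqrt_Rsqr_abs. rewrite <- (sqrt_Rsqr r) at 1 by lra.
  assert (0 <= 1 - x * x) by nra.
  rewrite <- sqrt_mult; [|apply Rle_0_sqr|assumption].
  f_equal. unfold Rsqr. rewrite hxr in e. nra. }
assert (hb := acos_bound x).
destruct (Rle_dec 0 (Im z)) as [hi|hi].
- exists (acos x). split; [lra|].
  unfold circle_point. rewrite cos_acos, sin_acos by exact hx. unfold Rsqr.
  rewrite hs, <- hxr, Rabs_pos_eq by exact hi. apply surjective_pairing.
- exists (2 * PI - acos x). split; [lra|].
  unfold circle_point.
    rewrite cos_minus, sin_minus, cos_2PI, sin_2PI, cos_acos, sin_acos by exact hx.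
  unfold Rsqr.
  replace (r * (1 * x + 0 * sqrt (1 - x * x))) with (Re z) by (rewrite hxr; ring).
  replace (r * (0 * x - 1 * sqrt (1 - x * x))) with (- (r * sqrt (1 - x * x))) by ring.
  rewrite hs, Rabs_left by lra. rewrite Ropp_involutive. apply surjective_pairing.
Qed.

Lemma continuity_2d_Cmod (A : C -> C) r t :
  (forall z, in_disc z -> Ccontinuous A z) -> -1 < r < 1 ->
  continuity_2d_pt (fun u v => Cmod (A (circle_point u v))) r t.
Proof.
intros hA hr.
assert (c : ccont_2d (fun u v => A (circle_point u v)) r t).
{ apply continuity_2d_comp_C; [now apply hA, in_disc_circle_point|].
  apply (ccont_2d_circle_point (fun u _ => u)), continuity_2d_pt_id1. }
assert (d := continuity_2d_dot _ _ r t c c).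
apply (continuity_2d_pt_ext (fun u v => sqrt (dot (A (circle_point u v)) (A (circle_point u v))))).
- intros u v. rewrite dot_self, sqrt_pow2; [reflexivity|apply Cmod_ge_0].
- apply continuity_1d_2d_pt_comp with (2 := d).
  apply continuity_pt_filterlim, continuous_sqrt.
Qed.

Lemma Minf_is_lub (A : C -> C) r :
  (forall z, in_disc z -> Ccontinuous A z) -> 0 <= r < 1 ->
  is_lub (fun x => exists z, Cmod z = r /\ x = Cmod (A z)) (Minf r A).
Proof.
intros hA hr.
assert (hPI := PI_RGT_0).
destruct (continuity_ab_maj (fun t => Cmod (A (circle_point r t))) 0 (2 * PI)) as [t0 [ht0 _]].
- lra.
- intros t _. apply continuity_pt_filterlim.
  apply (continuity_2d_slice (fun u v => Cmod (A (circle_point u v)))).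
  apply continuity_2d_Cmod; [exact hA|lra].
- destruct (Lub_Rbar_correct (fun x => exists z, Cmod z = r /\ x = Cmod (A z))) as [h1 h2].
  unfold Minf. set (L := Lub_Rbar _) in *.
  assert (hle : Rbar_le L (Cmod (A (circle_point r t0)))).
  { apply h2. intros x (z & hz & ->). simpl.
    destruct (polar_form z) as (t & ht & ->). rewrite hz. now apply ht0. }
  assert (hge := h1 _ (ex_intro _ (circle_point r 0) (conj
    (eq_trans (Cmod_circle_point r 0) (Rabs_pos_eq r (proj1 hr))) eq_refl))).
  destruct L as [l| |]; simpl in hle, hge; try contradiction.
  split.
  + intros x hx. exact (h1 x hx).
  + intros b hb. apply (h2 b). intros x hx. now apply hb.
Qed.

Lemma Cmod_le_Minf (A : C -> C) z :
  (forall z, in_disc z -> Ccontinuous A z) -> in_disc z -> Cmod (A z) <= Minf (Cmod z) A.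
Proof.
intros hA hz. apply Minf_is_lub; [exact hA|split; [apply Cmod_ge_0|exact hz]|]. now exists z.
Qed.

Lemma Minf_nonneg (A : C -> C) r :
  (forall z, in_disc z -> Ccontinuous A z) -> 0 <= r < 1 -> 0 <= Minf r A.
Proof.
intros hA hr. apply Rle_trans with (1 := Cmod_ge_0 (A (circle_point r 0))).
apply Minf_is_lub; [exact hA|exact hr|]. exists (circle_point r 0). split; [|reflexivity].
rewrite Cmod_circle_point. now apply Rabs_pos_eq.
Qed.

(** The absolute value extends the maximum modulus evenly to [(-1, 1)], which makes [0] an
    interior point for differentiation under the primitive. *)
Lemma continuous_Minf_abs (A : C -> C) r :
  (forall z, in_disc z -> Ccontinuous A z) -> -1 < r < 1 -> continuous (fun s => Minf (Rabs s) A) r.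
Proof.
intros hA hr. apply filterlim_locally. intros eps.
assert (hPI := PI_RGT_0).
assert (he : 0 < eps / 2) by (pose proof (cond_pos eps); lra).
destruct (uniform_continuity_2d_1d' (fun u v => Cmod (A (circle_point u v))) 0 (2 * PI) r
  (fun t _ => continuity_2d_Cmod A r t hA hr) (mkposreal _ he)) as [d hd].
assert (hd' : forall s t, Rabs (s - r) < d -> 0 <= t <= 2 * PI ->
  Rabs (Cmod (A (circle_point s t)) - Cmod (A (circle_point r t))) < eps / 2).
{ intros s t hs ht. apply Rabs_lt_between' in hs. pose proof (cond_pos d).
  apply hd; try lra. rewrite Rminus_diag, Rabs_R0. lra. }
assert (habs : forall s, -1 < s < 1 -> 0 <= Rabs s < 1).
{ intros s hs. split; [apply Rabs_pos|now apply Rabs_def1]. }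
assert (hsup : forall s z, Cmod z = Rabs s -> exists t, 0 <= t <= 2 * PI /\ z = circle_point s t).
{ intros s z hz. destruct (Rle_dec 0 s) as [h|h].
  - rewrite Rabs_pos_eq in hz by exact h. rewrite <- hz. apply polar_form.
  - rewrite Rabs_left in hz by lra.
    destruct (polar_form (- z)%C) as (t & ht & e). rewrite Cmod_opp, hz in e.
    exists t. split; [exact ht|]. replace z with (- - z)%C by ring. rewrite e.
    unfold circle_point, Copp; simpl. f_equal; ring. }
assert (hle : forall s s', -1 < s < 1 -> -1 < s' < 1 ->
  (forall t, 0 <= t <= 2 * PI ->
     Cmod (A (circle_point s t)) <= Cmod (A (circle_point s' t)) + eps / 2) ->
  Minf (Rabs s) A <= Minf (Rabs s') A + eps / 2).
{ intros s s' hs hs' h. apply (Minf_is_lub A (Rabs s) hA); [now apply habs|].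
  intros x (z & hz & ->). destruct (hsup s z hz) as (t & ht & ->).
  apply Rle_trans with (1 := h t ht).
  apply Rplus_le_compat_r. apply (Minf_is_lub A (Rabs s') hA); [now apply habs|].
  exists (circle_point s' t). split; [apply Cmod_circle_point|reflexivity]. }
generalize (filter_and _ _ (open_interval_locally r hr) (locally_ball r d)).
apply filter_imp. intros s [hs hb].
assert (k := fun t ht => hd' s t hb ht).
apply Rabs_lt_between'.
assert (Minf (Rabs s) A <= Minf (Rabs r) A + eps / 2).
{ apply hle; auto. intros t ht. specialize (k t ht). apply Rabs_lt_between' in k. lra. }
assert (Minf (Rabs r) A <= Minf (Rabs s) A + eps / 2).
{ apply hle; auto. intros t ht. specialize (k t ht). apply Rabs_lt_between' in k. lra. }
lra.
Qed.

(** * Growth of solutions *)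

Lemma dot_le_Cmod z w : dot z w <= Cmod z * Cmod w.
Proof.
pose proof (Cmod_ge_0 z). pose proof (Cmod_ge_0 w).
assert (e1 := Cmod2_alt z). assert (e2 := Cmod2_alt w).
apply Rnot_lt_le. intros h.
assert (h2 : (Cmod z * Cmod w) ^ 2 < dot z w ^ 2).
{ assert (0 <= Cmod z * Cmod w) by now apply Rmult_le_pos. nra. }
rewrite Rpow_mult_distr, e1, e2 in h2. unfold dot in h2.
pose proof (pow2_ge_0 (Re z * Im w - Im z * Re w)). nra.
Qed.

(** Reduces estimates of complex-valued functions to real ones: a modulus is the supremum of
    the functionals [dot u] over unit vectors [u], and these are differentiable along curves
    while the modulus is not. *)
Lemma Cmod_le_of_dot w b : 0 <= b -> (forall u, dot u w <= Cmod u * b) -> Cmod w <= b.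
Proof.
intros hb H. specialize (H w). rewrite dot_self in H. pose proof (Cmod_ge_0 w). nra.
Qed.

Lemma dot_derive_along (h h1 : C -> C) (u e : C) (t theta : R) :
  deriv_on_disc h h1 -> -1 < t < 1 ->
  is_derive (fun s => dot u (h (circle_point s theta) * e)%C) t
    (dot u (h1 (circle_point t theta) * circle_point 1 theta * e)%C).
Proof.
intros hh ht.
assert (d : is_cderive (fun s => h (circle_point s theta) * e)%C t
   (h1 (circle_point t theta) * circle_point 1 theta * e + h (circle_point t theta) * RtoC 0)%C).
{ apply (is_cderive_mult (fun s => h (circle_point s theta)) (fun _ => e));
    [|apply is_cderive_const].
  apply C_derive_along; [now apply hh, in_disc_circle_point|apply is_cderive_radius]. }
evar_last.
- apply (is_derive_dot (fun _ => u)); [apply is_cderive_const|exact d].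
- unfold dot, Re, Im, Cmult, Cplus, RtoC; simpl. ring.
Qed.

Definition growth_exponent (A : C -> C) (t : R) : R :=
  RInt (fun s => Minf (Rabs s) A * (1 - s)) 0 t.

(** Bounds [|f''| = |A f|] at radius [t] for a solution with
    [|f| <= K exp (growth_exponent A t)]. *)
Definition second_derivative_bound (A : C -> C) (K t : R) : R :=
  K * (Minf (Rabs t) A * exp (growth_exponent A t)).

Lemma is_derive_growth_exponent (A : C -> C) t :
  (forall z, in_disc z -> Ccontinuous A z) -> -1 < t < 1 ->
  is_derive (growth_exponent A) t (Minf (Rabs t) A * (1 - t)).
Proof.
intros hA ht. apply (is_derive_RInt_0 (fun s => Minf (Rabs s) A * (1 - s))); [|exact ht].
intros s hs.
apply (continuous_mult (K := R_AbsRing) (fun s => Minf (Rabs s) A) (fun s => 1 - s)).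
- now apply continuous_Minf_abs.
- eapply continuous_of_is_derive. auto_derive; [exact I|reflexivity].
Qed.

Lemma continuous_exp_growth_exponent (A : C -> C) t :
  (forall z, in_disc z -> Ccontinuous A z) -> -1 < t < 1 ->
  continuous (fun s => exp (growth_exponent A s)) t.
Proof.
intros hA ht. apply (continuous_comp (growth_exponent A) exp); [|apply continuous_exp].
eapply continuous_of_is_derive. now apply is_derive_growth_exponent.
Qed.

Lemma continuous_second_derivative_bound (A : C -> C) K t :
  (forall z, in_disc z -> Ccontinuous A z) -> -1 < t < 1 ->
  continuous (second_derivative_bound A K) t.
Proof.
intros hA ht.
apply (continuous_scal_r (K := R_AbsRing) (V := R_NormedModule) K
  (fun t => Minf (Rabs t) A * exp (growth_exponent A t))).
apply (continuous_mult (K := R_AbsRing) (fun t => Minf (Rabs t) A)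
  (fun t => exp (growth_exponent A t))).
- now apply continuous_Minf_abs.
- now apply continuous_exp_growth_exponent.
Qed.

Lemma second_derivative_bound_nonneg (A : C -> C) K t :
  (forall z, in_disc z -> Ccontinuous A z) -> 0 <= K -> 0 <= t < 1 ->
  0 <= second_derivative_bound A K t.
Proof.
intros hA hK ht. apply Rmult_le_pos; [exact hK|].
apply Rmult_le_pos; [|left; apply exp_pos].
apply Minf_nonneg; [exact hA|]. now rewrite Rabs_pos_eq.
Qed.

(** Along a ray put [b t = M t |f|], with [M] the maximum modulus of [A]; it bounds [|f''|].
    Integrating twice, [|f|] is at most [Ga t - (1 - t) B1 t <= Ga t], where [B1] is a primitive
    of [b] bounding [|f'|] and [Ga] is a primitive of [(1 - t) b].  Hence
    [Ga' = (1 - t) M |f| <= E' Ga], and Gronwall's argument gives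
    [|f| <= (|f 0| + |f' 0|) exp E].  One more integration bounds [f']. *)
Lemma solution_derivative_growth (A f f1 : C -> C) (z : C) :
  (forall z, in_disc z -> Ccontinuous A z) ->
  deriv_on_disc f f1 -> deriv_on_disc f1 (fun z => - (A z * f z))%C ->
  in_disc z ->
  Cmod (f1 z) <= Cmod (f1 (RtoC 0)) +
    RInt (second_derivative_bound A (Cmod (f (RtoC 0)) + Cmod (f1 (RtoC 0)))) 0 (Cmod z).
Proof.
intros hA hf hf1 hz.
set (m := fun t => Minf (Rabs t) A).
set (E := growth_exponent A).
assert (m_cont : forall t, -1 < t < 1 -> continuous m t).
{ intros t. exact (continuous_Minf_abs A t hA). }
destruct (polar_form z) as (theta & _ & ez).
set (r := Cmod z) in *.
assert (hr : 0 <= r < 1) by (split; [apply Cmod_ge_0|exact hz]).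
rewrite ez. clear ez. clearbody r.
set (c0 := Cmod (f (RtoC 0))). set (c1 := Cmod (f1 (RtoC 0))).
assert (hc0 : 0 <= c0) by apply Cmod_ge_0. assert (hc1 : 0 <= c1) by apply Cmod_ge_0.
set (y := fun t => Cmod (f (circle_point t theta))).
set (b := fun t => m t * y t).
assert (hm : forall t, -1 < t < 1 -> 0 <= m t).
{ intros t ht. apply Minf_nonneg; [exact hA|]. split; [apply Rabs_pos|now apply Rabs_def1]. }
assert (hb0 : forall t, -1 < t < 1 -> 0 <= b t).
{ intros t ht. apply Rmult_le_pos; [now apply hm|apply Cmod_ge_0]. }
assert (hyc : forall t, -1 < t < 1 -> continuous y t).
{ intros t ht.
  assert (c := continuity_2d_Cmod f t theta
     (fun z hz => Ccontinuous_of_derive _ _ _ (hf z hz)) ht).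
  apply continuity_2d_pt_filterlim in c.
  apply (continuous_comp_2 (fun u : R => u) (fun _ : R => theta)
    (fun u v => Cmod (f (circle_point u v)))).
  - apply continuous_id.
  - apply continuous_const.
  - exact c. }
assert (hbc : forall t, -1 < t < 1 -> continuous b t).
{ intros t ht. apply (continuous_mult (K := R_AbsRing) m y); [now apply m_cont|now apply hyc]. }
assert (h1c : forall t : R, continuous (fun s => 1 - s) t).
{ intros t. eapply continuous_of_is_derive. auto_derive; [exact I|reflexivity]. }
set (B1 := fun t => c1 + RInt b 0 t).
set (Ga := fun t => (c0 + c1) + RInt (fun s => b s * (1 - s)) 0 t).
assert (dB1 : forall t, -1 < t < 1 -> is_derive B1 t (b t)).
{ intros t ht. now apply is_derive_primitive. }
assert (dGa : forall t, -1 < t < 1 -> is_derive Ga t (b t * (1 - t))).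
{ intros t ht. apply (is_derive_primitive (fun s => b s * (1 - s))); [|exact ht].
  intros s hs. apply (continuous_mult (K := R_AbsRing) b (fun s => 1 - s)); auto. }
assert (dE : forall t, -1 < t < 1 -> is_derive E t (m t * (1 - t))).
{ intros t ht. now apply is_derive_growth_exponent. }
assert (hB1 : forall t, 0 <= t < 1 -> 0 <= B1 t).
{ intros t ht. apply Rle_trans with (B1 0); [unfold B1; rewrite primitive_0; lra|].
  apply (nondecreasing_of_derive B1 b); [lra| |]; intros s hs; [apply dB1|apply hb0]; lra. }
set (e := circle_point 1 theta).
assert (he : Cmod e = 1) by (unfold e; rewrite Cmod_circle_point; apply Rabs_R1).
assert (hder : forall u t, 0 <= t < 1 ->
  dot u (f1 (circle_point t theta) * e)%C <= Cmod u * B1 t).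
{ intros u t ht.
  assert (k : Cmod u * B1 0 - dot u (f1 (circle_point 0 theta) * e)%C
     <= Cmod u * B1 t - dot u (f1 (circle_point t theta) * e)%C).
  { apply (nondecreasing_of_derive
     (fun t => Cmod u * B1 t - dot u (f1 (circle_point t theta) * e)%C)
     (fun t => Cmod u * b t
        - dot u (- (A (circle_point t theta) * f (circle_point t theta)) * e * e)%C)); [lra| |].
    - intros s hs. apply (is_derive_minus (V := R_NormedModule)).
      + apply (is_derive_scal B1). apply dB1. lra.
      + apply (dot_derive_along f1 _ u e s theta hf1). lra.
    - intros s hs.
      apply (proj1 (Rminus_le_0 _ _)).
      apply Rle_trans with (1 := dot_le_Cmod _ _).
      apply Rmult_le_compat_l; [apply Cmod_ge_0|].
      rewrite !Cmod_mult, Cmod_opp, Cmod_mult, he, !Rmult_1_r.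
      apply Rmult_le_compat_r; [apply Cmod_ge_0|].
      unfold m. rewrite <- (Cmod_circle_point s theta).
      apply Cmod_le_Minf; [exact hA|]. apply in_disc_circle_point. lra. }
  assert (k0 : dot u (f1 (circle_point 0 theta) * e)%C <= Cmod u * B1 0).
  { apply Rle_trans with (1 := dot_le_Cmod _ _).
    unfold B1. rewrite primitive_0, Cmod_mult, he, circle_point_0, Rmult_1_r. apply Rle_refl. }
  lra. }
assert (hval : forall t, 0 <= t < 1 -> y t <= Ga t).
{ intros t ht.
  assert (hX : y t <= Ga t - (1 - t) * B1 t).
  2:{ specialize (hB1 t ht). nra. }
  set (X := fun t => Ga t - (1 - t) * B1 t).
  assert (dX : forall t, -1 < t < 1 -> is_derive X t (B1 t)).
  { intros s hs. evar_last.
    - apply (is_derive_minus (V := R_NormedModule)); [now apply dGa|].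
      apply (is_derive_mult (K := R_AbsRing) (fun s => 1 - s) B1);
          [|now apply dB1|apply Rmult_comm].
      auto_derive; [exact I|reflexivity].
    - unfold minus, plus, opp, mult; simpl. ring. }
  assert (hX0 : X 0 = c0) by (unfold X, Ga, B1; rewrite !primitive_0; ring).
  apply Cmod_le_of_dot.
  - change (0 <= X t). apply Rle_trans with (X 0); [lra|].
    apply (nondecreasing_of_derive X B1); [lra| |]; intros s hs; [apply dX|apply hB1]; lra.
  - intros u.
    assert (k : Cmod u * X 0 - dot u (f (circle_point 0 theta) * RtoC 1)%C
       <= Cmod u * X t - dot u (f (circle_point t theta) * RtoC 1)%C).
    { apply (nondecreasing_of_derive
        (fun t => Cmod u * X t - dot u (f (circle_point t theta) * RtoC 1)%C)
        (fun t => Cmod u * B1 t - dot u (f1 (circle_point t theta) * e * RtoC 1)%C)); [lra| |].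
      - intros s hs. apply (is_derive_minus (V := R_NormedModule)).
        + apply (is_derive_scal X). apply dX. lra.
        + apply (dot_derive_along f _ u (RtoC 1) s theta hf). lra.
      - intros s hs. rewrite Cmult_1_r. apply (proj1 (Rminus_le_0 _ _)), hder. lra. }
    rewrite !Cmult_1_r, circle_point_0, hX0 in k.
    assert (k0 := dot_le_Cmod u (f (RtoC 0))). fold c0 in k0.
    change (dot u (f (circle_point t theta)) <= Cmod u * X t). lra. }
assert (hgron : forall t, 0 <= t < 1 -> y t <= (c0 + c1) * exp (E t)).
{ intros t ht. apply Rle_trans with (1 := hval t ht).
  assert (k : - (Ga 0 * exp (- E 0)) <= - (Ga t * exp (- E t))).
  { apply (nondecreasing_of_derive (fun t => - (Ga t * exp (- E t)))
      (fun t => (m t * (1 - t) * Ga t - b t * (1 - t)) * exp (- E t))); [lra| |].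
    - intros s hs. assert (d1 := dGa s ltac:(lra)). assert (d2 := dE s ltac:(lra)).
      clearbody Ga E. auto_derive; [repeat split; eexists; eassumption|].
      change (fun x0 : R => Ga x0) with Ga. change (fun x0 : R => E x0) with E.
      rewrite (is_derive_unique _ _ _ d1), (is_derive_unique _ _ _ d2). ring.
    - intros s hs. apply Rmult_le_pos; [|left; apply exp_pos].
      specialize (hval s ltac:(lra)). specialize (hm s ltac:(lra)). unfold b.
      replace (m s * (1 - s) * Ga s - m s * y s * (1 - s))
        with (m s * (1 - s) * (Ga s - y s)) by ring.
      repeat apply Rmult_le_pos; lra. }
  assert (hE0 : E 0 = 0) by apply RInt_0_0.
  assert (hGa0 : Ga 0 = c0 + c1) by apply primitive_0.
  rewrite hE0, hGa0, Ropp_0, exp_0 in k.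
  rewrite exp_Ropp in k. pose proof (exp_pos (E t)) as hE.
  apply Rmult_le_reg_r with (/ exp (E t)); [now apply Rinv_0_lt_compat|].
  rewrite Rmult_assoc, Rinv_r by lra. lra. }
set (p := second_derivative_bound A (c0 + c1)).
assert (hpc : forall t, -1 < t < 1 -> continuous p t).
{ intros t ht. now apply continuous_second_derivative_bound. }
apply Rle_trans with (B1 r).
- replace (Cmod (f1 (circle_point r theta))) with (Cmod (f1 (circle_point r theta) * e)%C).
  + apply Cmod_le_of_dot; [now apply hB1|]. intros u. now apply hder.
  + rewrite Cmod_mult, he. apply Rmult_1_r.
- assert (k : (c1 + RInt p 0 0) - B1 0 <= (c1 + RInt p 0 r) - B1 r).
  { apply (nondecreasing_of_derive (fun t => (c1 + RInt p 0 t) - B1 t) (fun t => p t - b t));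
      [lra| |].
    - intros t ht. apply (is_derive_minus (V := R_NormedModule)).
      + apply is_derive_primitive; [exact hpc|lra].
      + apply dB1. lra.
    - intros t ht. specialize (hgron t ltac:(lra)). specialize (hm t ltac:(lra)).
      change (p t) with ((c0 + c1) * (m t * exp (E t))). unfold b. nra. }
  unfold B1 at 1 in k. rewrite !primitive_0 in k. lra.
Qed.

Lemma RInt_le_of_ex_RInt_gen (k : R -> R) (a : R) :
  a < 1 ->
  (forall x, a <= x < 1 -> continuous k x) ->
  (forall x, a <= x < 1 -> 0 <= k x) ->
  ex_RInt_gen (V := R_NormedModule) k (at_point a) (at_left 1) ->
  exists B, forall r, a <= r < 1 -> RInt k a r <= B.
Proof.
intros ha hc hk [l hl].
destruct (hl (fun y => ball l 1 y) (locally_ball l (mkposreal 1 Rlt_0_1))) as [P Q hP [d hQ] hPQ].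
exists (l + 1). intros r hr.
set (s := Rmax r (1 - d / 2)).
assert (hd := cond_pos d).
assert (hs : r <= s < 1) by (unfold s; split; [apply Rmax_l|apply Rmax_lub_lt; lra]).
assert (hs2 : 1 - d / 2 <= s) by apply Rmax_r.
destruct (hPQ a s hP) as (v & hv & hb).
{ apply hQ; [|lra]. apply Rabs_lt_between'. lra. }
simpl in hv. apply Rabs_lt_between' in hb.
assert (ex : forall x y, a <= x -> x <= y -> y < 1 -> ex_RInt k x y).
{ intros x y hx hxy hy. apply (ex_RInt_continuous (V := R_CompleteNormedModule)).
  intros z hz. apply hc. rewrite Rmin_left, Rmax_right in hz by lra. lra. }
rewrite <- (is_RInt_unique _ _ _ _ hv) in hb.
rewrite <- (RInt_Chasles k a r s) in hb by (apply ex; lra).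
assert (h0 : 0 <= RInt k r s).
{ apply RInt_ge_0; [lra|apply ex; lra|]. intros x hx. apply hk. lra. }
unfold plus in hb; simpl in hb. lra.
Qed.

(** Starting the exponent at [0] instead of [r0] multiplies the integrand of the hypothesis by
    the constant [exp (growth_exponent A r0) ^ 2]; the rest is [1 - r <= 1 - r ^ 2]. *)
Lemma second_derivative_bound_integrable (A : C -> C) (K r0 : R) :
  (forall z, in_disc z -> Ccontinuous A z) -> 0 <= r0 < 1 ->
  ex_RInt_gen (V := R_NormedModule)
    (fun r => Minf r A ^ 2
              * exp (2 * RInt (fun t => Minf t A * (1 - t)) r0 r)
              * (1 - r ^ 2) ^ 3)
    (at_point r0) (at_left 1) ->
  exists B, forall r, 0 <= r < 1 ->
    RInt (fun s => second_derivative_bound A K s ^ 2 * (1 - s) ^ 3) 0 r <= B.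
Proof.
intros hA hr0 hI.
set (m := fun t => Minf (Rabs t) A).
set (E := growth_exponent A).
set (p := second_derivative_bound A K).
assert (hp : forall t, -1 < t < 1 -> continuous p t).
{ intros t. now apply continuous_second_derivative_bound. }
assert (hpow : forall (g : R -> R) n t, continuous g t -> continuous (fun s => g s ^ n) t).
{ intros g n t hg. apply (continuous_comp g (fun v => v ^ n)); [exact hg|].
  eapply continuous_of_is_derive. auto_derive; [exact I|reflexivity]. }
set (k := fun r => m r ^ 2 * exp (E r) ^ 2 * (1 - r ^ 2) ^ 3).
assert (hk : forall t, -1 < t < 1 -> continuous k t).
{ intros t ht.
  apply (continuous_mult (K := R_AbsRing) (fun r => m r ^ 2 * exp (E r) ^ 2)
      (fun r => (1 - r ^ 2) ^ 3)).
  - apply (continuous_mult (K := R_AbsRing) (fun r => m r ^ 2) (fun r => exp (E r) ^ 2));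
      apply hpow.
    + now apply continuous_Minf_abs.
    + now apply continuous_exp_growth_exponent.
  - eapply continuous_of_is_derive. auto_derive; [exact I|reflexivity]. }
assert (hk0 : forall x, r0 <= x < 1 -> 0 <= k x).
{ intros x hx. unfold k. apply Rmult_le_pos; [apply Rmult_le_pos; apply pow2_ge_0|].
  apply pow_le. nra. }
assert (hkint : exists B, forall r, r0 <= r < 1 -> RInt k r0 r <= B).
{ apply RInt_le_of_ex_RInt_gen; [lra|intros; apply hk; lra|exact hk0|].
  destruct hI as [l hl].
  exists (scal (exp (E r0) ^ 2) l).
  apply (is_RInt_gen_ext (fun r => scal (exp (E r0) ^ 2) (Minf r A ^ 2
                 * exp (2 * RInt (fun t => Minf t A * (1 - t)) r0 r)
                 * (1 - r ^ 2) ^ 3))).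
  2:{ apply (is_RInt_gen_scal (V := R_NormedModule)). exact hl. }
  exists (fun x => x = r0) (fun x => r0 <= x < 1).
  - reflexivity.
  - assert (hd : 0 < 1 - r0) by lra. exists (mkposreal _ hd). intros x hx hx1.
    apply Rabs_lt_between' in hx. simpl in hx. lra.
  - intros x y -> hy t. simpl. rewrite Rmin_left, Rmax_right by lra. intros ht.
    assert (e : E t = E r0 + RInt (fun t => Minf t A * (1 - t)) r0 t).
    { set (w := fun s => m s * (1 - s)).
      assert (hw : forall t, -1 < t < 1 -> continuous w t).
      { intros s hs. apply (continuous_mult (K := R_AbsRing) m (fun s => 1 - s)).
        - now apply continuous_Minf_abs.
        - eapply continuous_of_is_derive. auto_derive; [exact I|reflexivity]. }
      change (E t) with (RInt w 0 t). change (E r0) with (RInt w 0 r0).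
      rewrite (RInt_ext (fun t => Minf t A * (1 - t)) w).
      - rewrite <- (RInt_Chasles w 0 r0 t); [reflexivity|..];
          apply (ex_RInt_continuous (V := R_CompleteNormedModule)); intros z hz; apply hw;
          rewrite Rmin_left, Rmax_right in hz by lra; lra.
      - intros x. rewrite Rmin_left, Rmax_right by lra. intros hx. unfold w, m.
        rewrite Rabs_pos_eq by lra. reflexivity. }
    unfold k. rewrite e, exp_plus. unfold m. rewrite Rabs_pos_eq by lra.
    unfold scal; simpl; unfold mult; simpl.
    replace (2 * RInt (fun t => Minf t A * (1 - t)) r0 t)
      with (RInt (fun t => Minf t A * (1 - t)) r0 t + RInt (fun t => Minf t A * (1 - t)) r0 t)
          by ring.
    rewrite exp_plus. ring. }
destruct hkint as [B hB].
set (q := fun s => p s ^ 2 * (1 - s) ^ 3).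
assert (hq : forall t, -1 < t < 1 -> continuous q t).
{ intros t ht. apply (continuous_mult (K := R_AbsRing) (fun s => p s ^ 2) (fun s => (1 - s) ^ 3)).
  - now apply hpow, hp.
  - eapply continuous_of_is_derive. auto_derive; [exact I|reflexivity]. }
assert (hq0 : forall x, 0 <= x < 1 -> 0 <= q x).
{ intros x hx. apply Rmult_le_pos; [apply pow2_ge_0|apply pow_le; lra]. }
assert (exq : forall x y, 0 <= x -> x <= y -> y < 1 -> ex_RInt q x y).
{ intros x y hx hxy hy. apply (ex_RInt_continuous (V := R_CompleteNormedModule)).
  intros z hz. apply hq. rewrite Rmin_left, Rmax_right in hz by lra. lra. }
assert (hqle : forall r, r0 <= r < 1 -> RInt q r0 r <= K ^ 2 * B).
{ intros r hr.
  apply Rle_trans with (RInt (fun x => K ^ 2 * k x) r0 r).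
  - apply RInt_le; [lra|apply exq; lra| |].
    + apply (ex_RInt_scal (V := R_NormedModule)).
      apply (ex_RInt_continuous (V := R_CompleteNormedModule)).
      intros z hz. apply hk. rewrite Rmin_left, Rmax_right in hz by lra. lra.
    + intros x hx. change (q x) with ((K * (m x * exp (E x))) ^ 2 * (1 - x) ^ 3). unfold k.
      replace ((K * (m x * exp (E x))) ^ 2 * (1 - x) ^ 3)
        with (K ^ 2 * (m x ^ 2 * exp (E x) ^ 2 * (1 - x) ^ 3)) by ring.
      apply Rmult_le_compat_l; [apply pow2_ge_0|].
      apply Rmult_le_compat_l; [apply Rmult_le_pos; apply pow2_ge_0|].
      apply pow_incr. nra.
  - rewrite (RInt_scal (V := R_CompleteNormedModule) k).
    + apply Rmult_le_compat_l; [apply pow2_ge_0|now apply hB].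
    + apply (ex_RInt_continuous (V := R_CompleteNormedModule)).
      intros z hz. apply hk. rewrite Rmin_left, Rmax_right in hz by lra. lra. }
exists (RInt q 0 r0 + Rmax 0 (K ^ 2 * B)).
intros r hr. change (RInt q 0 r <= RInt q 0 r0 + Rmax 0 (K ^ 2 * B)).
destruct (Rle_dec r0 r) as [h|h].
- rewrite <- (RInt_Chasles q 0 r0 r) by (apply exq; lra).
  apply Rplus_le_compat_l. apply Rle_trans with (2 := Rmax_r _ _). apply hqle. lra.
- assert (e := RInt_Chasles (V := R_CompleteNormedModule) q 0 r r0 (exq 0 r ltac:(lra)
    ltac:(lra) ltac:(lra)) (exq r r0 ltac:(lra) ltac:(lra) ltac:(lra))).
  change (RInt q 0 r + RInt q r r0 = RInt q 0 r0) in e.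
  assert (0 <= RInt q r r0).
  { apply RInt_ge_0; [lra|apply exq; lra|]. intros x hx. apply hq0. lra. }
  pose proof (Rmax_l 0 (K ^ 2 * B)). lra.
Qed.

(* The integrand is continuous and nonnegative on [r0, 1), so finiteness of the
   integral is convergence of the improper integral at 1. *)
Theorem theorem9 (A : C -> C) (hA : analytic_disc A)
  (hint : exists r0 : R, 0 <= r0 < 1 /\
     ex_RInt_gen (V := R_NormedModule)
       (fun r => Minf r A ^ 2
                 * exp (2 * RInt (fun t => Minf t A * (1 - t)) r0 r)
                 * (1 - r ^ 2) ^ 3)
       (at_point r0) (at_left 1)) :
  forall f : C -> C, analytic_solution A f -> VMOA f.
Proof.
intros f (_ & f1 & f2 & hf & hf1 & hode).
destruct hint as (r0 & hr0 & hI).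
assert (hAc : forall z, in_disc z -> Ccontinuous A z).
{ intros z hz. destruct (hA z hz) as [d hd]. now apply Ccontinuous_of_derive with d. }
assert (hf2 : deriv_on_disc f1 (fun z => - (A z * f z))%C).
{ intros z hz. replace (- (A z * f z))%C with (f2 z); [now apply hf1|].
  assert (e := hode z hz).
  replace (f2 z) with (f2 z + A z * f z - A z * f z)%C by ring. rewrite e. ring. }
assert (hholo : holo2 f f1 (fun z => - (A z * f z))%C).
{ split; [exact hf|split; [exact hf2|]]. intros z hz.
  apply (continuous_opp (V := AbsRing_NormedModule C_AbsRing)
    (U := AbsRing_UniformSpace C_AbsRing) (fun z => A z * f z)%C).
  apply Ccontinuous_mult; [now apply hAc|].
  apply Ccontinuous_of_derive with (f1 z). now apply hf. }
set (c0 := Cmod (f (RtoC 0))). set (c1 := Cmod (f1 (RtoC 0))).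
assert (hc0 : 0 <= c0) by apply Cmod_ge_0. assert (hc1 : 0 <= c1) by apply Cmod_ge_0.
destruct (second_derivative_bound_integrable A (c0 + c1) r0 hAc hr0 hI) as [B hB].
destruct (radial_majorant (second_derivative_bound A (c0 + c1)) c1 B)
  as (F & F1 & F2 & S & hF & hF1 & hS & hD); [..|exact hc1|exact hB|].
- intros t ht. now apply continuous_second_derivative_bound.
- intros t ht. apply second_derivative_bound_nonneg; [exact hAc|lra|exact ht].
- apply (VMOA_of_radial_majorant f f1 _ F F1 F2 S hholo hF hF1 hS).
  intros z hz.
  apply Rle_trans with
    ((c1 + RInt (second_derivative_bound A (c0 + c1)) 0 (Cmod z)) ^ 2).
  + apply pow_incr. split; [apply Cmod_ge_0|].
    exact (solution_derivative_growth A f f1 z hAc hf hf2 hz).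
  + apply hD. split; [apply Cmod_ge_0|exact hz].
Qed.
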